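(* Let $\aleph$ be an infinite cardinal, $\mathbb K$ a field, and $I$ an $\aleph$-poset having a finite cofinal subset. The primitive ideals of $\mathfrak B(I)$ are precisely those of the form $H(I,\{A\not\le\})$ for some nonempty chain $A$ of $I$, where $\{A\not\le\}=I\setminus\{k\in I: a\le k\text{ for some }a\in A\}$.
   Context: An ideal of a ring is right (left) primitive if it is the annihilator of a simple right (left) module; for $\mathfrak B(I)$ right primitive and left primitive ideals coincide, and one simply says primitive. Conventions. $\aleph$ is an infinite cardinal, regarded as an initial ordinal, so that $\emptyset\in\aleph$; $\mathbb K$ is a field. For a poset $P$, $\mathcal M(P)$ is the set of all maximal chains of $P$ (maximal totally ordered subsets). An $\aleph$-poset is a partially ordered set $I$ with $|I|\le\aleph$ and $|\mathcal M(I)|\le\aleph$. For $i\in I$: $\{i\le\}=\{k\in I: i\le k\}$, $\{\le i\}=\{k\in I:k\le i\}$, $\{i\not\le\}=I\setminus\{i\le\}$, with the induced orders. For a set $A$, $\aleph^{(A)}$ is the set of maps $p:A\to\aleph$ with $p(a)=\emptyset$ for all but finitely many $a\in A$. For a set $X$, $\mathrm{CFM}_X(\mathbb K)$ is the $\mathbb K$-algebra of column-finite $X\times X$ matrices over $\mathbb K$, and $\mathrm{FR}_X(\mathbb K)$ is its ideal of matrices with only finitely many nonzero rows; $a(x,y)$ denotes the entry of $a$ in row $x$, column $y$. Construction. Let $X(I)=\aleph^{(I)}\times\mathcal M(I)$ and $Q(I)=\mathrm{CFM}_{X(I)}(\mathbb K)$. For $i\in I$ let $X(i\le)=\aleph^{(\{i\le\})}\times\mathcal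 M(\{i\le\})$ and let $\psi_{I,i}:\mathrm{CFM}_{X(i\le)}(\mathbb K)\to Q(I)$ be the injective (not necessarily unital) $\mathbb K$-algebra homomorphism given, for $p,q\in\aleph^{(I)}$ and $A,B\in\mathcal M(I)$, by $$\psi_{I,i}(a)((p,A),(q,B))=a\big((p|_{\{i\le\}},A\cap\{i\le\}),(q|_{\{i\le\}},B\cap\{i\le\})\big)$$ if $i\in A\cap B$, $A\cap\{\le i\}=B\cap\{\le i\}$ and $p|_{\{i\not\le\}}=q|_{\{i\not\le\}}$, and $\psi_{I,i}(a)((p,A),(q,B))=0$ otherwise. Put $H(I,i)=\psi_{I,i}(\mathrm{FR}_{X(i\le)}(\mathbb K))$ if $i$ is not a maximal element of $I$, and $H(I,i)=\mathbb K\,\psi_{I,i}(\mathbf 1)$ if $i$ is a maximal element of $I$. For $J\subseteq I$ put $H(I,J)=\sum_{j\in J}H(I,j)\subseteq Q(I)$; this sum is direct and $H(I,J)$ is a (not necessarily unital) $\mathbb K$-subalgebra of $Q(I)$. Finally $\mathfrak B(I)=H(I,I)$, which is a unital subalgebra of $Q(I)$ when $I$ has a finite cofinal subset. *)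

(* Defs.v *)
From HB Require Import structures.
From mathcomp Require Import all_boot all_order all_algebra finmap.
From mathcomp Require Import mathcomp_extra boolp classical_sets functions.
From mathcomp Require Import cardinality fsbigop.
From mathcomp Require wochoice.

Set Implicit Arguments.
Unset Strict Implicit.
Unset Printing Implicit Defensive.

Import Order.TTheory GRing.Theory.

Local Open Scope classical_set_scope.
Local Open Scope card_scope.
Local Open Scope ring_scope.

Record cfm (K : pzRingType) (X : Type) := CFM {
  cfm_fun :> X -> X -> K;
  cfm_finite : forall y, finite_set [set x | cfm_fun x y != 0] }.

Lemma cfmP (K : pzRingType) (X : Type) (a b : cfm K X) :
  (forall x y, a x y = b x y) -> a = b.
Proof.
case: a b => [a fa] [b fb] /= ab.
have eab : a = b by apply/funext => x; apply/funext => y.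
by move: eab fa fb => -> fa fb; congr CFM; exact: Prop_irrelevance.
Qed.

HB.instance Definition _ (K : pzRingType) (X : Type) := gen_eqMixin (cfm K X).
HB.instance Definition _ (K : pzRingType) (X : Type) :=
  gen_choiceMixin (cfm K X).

Section CfmRing.
Variables (K : pzRingType) (X : choiceType).
Implicit Types a b c : cfm K X.

Lemma cfm0_finite (y : X) : finite_set [set x : X | (0 : K) != 0].
Proof. apply: (sub_finite_set _ (finite_set0 X)) => x /=. by rewrite eqxx. Qed.
Definition cfm0 := @CFM K X (fun _ _ => 0) cfm0_finite.

Lemma cfm1_finite (y : X) : finite_set [set x : X | (x == y)%:R != 0 :> K].
Proof.
apply: (sub_finite_set _ (finite_set1 y)) => x /=.
by case: (eqVneq x y) => //= _; rewrite mulr0n eqxx.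
Qed.
Definition cfm1 := @CFM K X (fun x y => (x == y)%:R) cfm1_finite.

Lemma cfmN_finite a (y : X) : finite_set [set x | - a x y != 0].
Proof. by apply: (sub_finite_set _ (cfm_finite a y)) => x /=; rewrite oppr_eq0. Qed.
Definition cfmN a := CFM (cfmN_finite a).

Lemma cfmD_finite a b (y : X) : finite_set [set x | a x y + b x y != 0].
Proof.
have : finite_set ([set x | a x y != 0] `|` [set x | b x y != 0]).
  by rewrite finite_setU; split; exact: cfm_finite.
apply: sub_finite_set => x /=; case: (eqVneq (a x y) 0) => [->|]; last by left.
by rewrite add0r; right.
Qed.
Definition cfmD a b := CFM (@cfmD_finite a b).

Definition cfm_mul_fun a b (x y : X) : K := \sum_(z \in setT) a x z * b z y.

Lemma cfm_mul_neq0 a b x y : cfm_mul_fun a b x y != 0 ->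
  exists2 z, a x z != 0 & b z y != 0.
Proof.
apply: contra_neqP => /forall2NP nab; apply: fsbig1 => z _.
have [/negP/negPn/eqP->|/negP/negPn/eqP->] := nab z; first by rewrite mul0r.
by rewrite mulr0.
Qed.

Lemma cfmM_finite a b (y : X) : finite_set [set x | cfm_mul_fun a b x y != 0].
Proof.
have : finite_set (\bigcup_(z in [set z | b z y != 0]) [set x | a x z != 0]).
  by apply: bigcup_finite => [|z _]; exact: cfm_finite.
by apply: sub_finite_set => x /= /cfm_mul_neq0[z ? ?]; exists z.
Qed.
Definition cfmM a b := CFM (@cfmM_finite a b).

Lemma cfm_mulE (A : {fset X}) a b x y :
  (forall z, z \notin A -> b z y = 0) -> cfmM a b x y = \sum_(z <- A) a x z * b z y.
Proof.
by move=> bA; apply: fsbigTE => z zA; rewrite bA ?mulr0.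
Qed.

Lemma cfm_supp b y : exists A : {fset X}, forall z, z \notin A -> b z y = 0.
Proof.
have /finite_fsetP[A eA] := cfm_finite b y; exists A => z zA.
apply/eqP; apply: contraNT zA => bz.
by have : [set` A] z by rewrite -eA.
Qed.

Lemma cfm_supp2 b c y : exists A : {fset X}, forall z, z \notin A ->
  b z y = 0 /\ c z y = 0.
Proof.
have [A bA] := cfm_supp b y; have [C cC] := cfm_supp c y.
exists (A `|` C)%fset => z; rewrite inE negb_or => /andP[zA zC].
by rewrite bA ?cC.
Qed.

Lemma cfmDA : associative cfmD.
Proof. by move=> a b c; apply: cfmP => x y /=; rewrite addrA. Qed.
Lemma cfmDC : commutative cfmD.
Proof. by move=> a b; apply: cfmP => x y /=; rewrite addrC. Qed.
Lemma cfm0D : left_id cfm0 cfmD.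
Proof. by move=> a; apply: cfmP => x y /=; rewrite add0r. Qed.
Lemma cfmND : left_inverse cfm0 cfmN cfmD.
Proof. by move=> a; apply: cfmP => x y /=; rewrite addNr. Qed.

Lemma cfmMDl : left_distributive cfmM cfmD.
Proof.
move=> a b c; apply: cfmP => x y; have [A cA] := cfm_supp c y.
rewrite [RHS]/= -[cfm_mul_fun a c x y]/(cfmM a c x y).
rewrite -[cfm_mul_fun b c x y]/(cfmM b c x y) !(cfm_mulE _ _ cA) -big_split.
by apply: eq_bigr => z _; rewrite /= mulrDl.
Qed.

Lemma cfmMDr : right_distributive cfmM cfmD.
Proof.
move=> a b c; apply: cfmP => x y; have [A bcA] := cfm_supp2 b c y.
rewrite [RHS]/= -[cfm_mul_fun a c x y]/(cfmM a c x y).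
rewrite -[cfm_mul_fun a b x y]/(cfmM a b x y) !(@cfm_mulE A).
- by rewrite -big_split; apply: eq_bigr => z _; rewrite /= mulrDr.
- by move=> z /bcA[].
- by move=> z /bcA[].
- by move=> z /bcA[/= -> ->]; rewrite addr0.
Qed.

Lemma cfm1M : left_id cfm1 cfmM.
Proof.
move=> a; apply: cfmP => x y; rewrite /= /cfm_mul_fun.
rewrite (fsbigTE [fset x]%fset) => [|z].
  by rewrite big_seq_fset1 /= eqxx mul1r.
by rewrite inE eq_sym /= => /negbTE->; rewrite mul0r.
Qed.

Lemma cfmM1 : right_id cfm1 cfmM.
Proof.
move=> a; apply: cfmP => x y; rewrite /= /cfm_mul_fun.
rewrite (fsbigTE [fset y]%fset) => [|z].
  by rewrite big_seq_fset1 /= eqxx mulr1.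
by rewrite inE /= => /negbTE->; rewrite mulr0.
Qed.

Lemma cfmMA : associative cfmM.
Proof.
move=> a b c; apply: cfmP => x y.
have [C cC] := cfm_supp c y.
have [A bA] : exists A : {fset X}, forall z w, w \in C -> z \notin A -> b z w = 0.
  have : finite_set (\bigcup_(w in [set` C]) [set z | b z w != 0]).
    by apply: bigcup_finite => [|w _]; [exact: finite_fset|exact: cfm_finite].
  case/finite_fsetP => A eA; exists A => z w wC zA.
  apply/eqP; apply: contraNT zA => bz.
  by have : [set` A] z by rewrite -eA; exists w.
have bcE z : cfmM b c z y = \sum_(w <- C) b z w * c w y by exact: cfm_mulE.
have -> : cfmM a (cfmM b c) x y =
    \sum_(z <- A) a x z * \sum_(w <- C) b z w * c w y.
  rewrite (@cfm_mulE A) => [|z zA].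
    by apply: eq_bigr => z _; rewrite bcE.
  by rewrite bcE big_seq big1 // => w wC; rewrite bA ?mul0r.
rewrite (cfm_mulE _ _ cC).
under eq_bigr do rewrite mulr_sumr; rewrite exchange_big /=.
rewrite big_seq [RHS]big_seq; apply: eq_bigr => w wC.
have -> : cfm_mul_fun a b x w = cfmM a b x w by [].
rewrite (@cfm_mulE A) => [|z zA]; last exact: bA.
by rewrite mulr_suml; apply: eq_bigr => z _; rewrite mulrA.
Qed.

HB.instance Definition _ := GRing.isZmodule.Build (cfm K X) cfmDA cfmDC cfm0D cfmND.
HB.instance Definition _ :=
  GRing.Zmodule_isPzRing.Build (cfm K X) cfmMA cfm1M cfmM1 cfmMDl cfmMDr.

Lemma cfm0E x y : (0 : cfm K X) x y = 0. Proof. by []. Qed.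
Lemma cfm1E x y : (1 : cfm K X) x y = (x == y)%:R. Proof. by []. Qed.
Lemma cfmNE a x y : (- a) x y = - a x y. Proof. by []. Qed.
Lemma cfmDE a b x y : (a + b) x y = a x y + b x y. Proof. by []. Qed.
Lemma cfmME a b x y : (a * b) x y = \sum_(z \in setT) a x z * b z y.
Proof. by []. Qed.

Lemma cfm_sumE (T : Type) (r : seq T) (P : pred T) (F : T -> cfm K X) x y :
  (\sum_(i <- r | P i) F i) x y = \sum_(i <- r | P i) F i x y.
Proof. by elim/big_rec2: _ => // i c a _ <-; rewrite cfmDE. Qed.

Definition FR : set (cfm K X) :=
  [set a | finite_set [set x | exists y, a x y != 0]].

Lemma FRM a b : FR a -> FR (a * b).
Proof.
by apply: sub_finite_set => x /= [y] /cfm_mul_neq0[z az _]; exists z.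
Qed.

Lemma FRMr a b : FR b -> FR (a * b).
Proof.
move=> fb.
have : finite_set (\bigcup_(z in [set z | exists y, b z y != 0])
                     [set x | a x z != 0]).
  by apply: bigcup_finite => // z _; exact: cfm_finite.
apply: sub_finite_set => x /= [y] /cfm_mul_neq0[z az bz]; exists z => //=.
by exists y.
Qed.

Lemma FRN a : FR a -> FR (- a).
Proof.
by apply: sub_finite_set => x /= [y]; rewrite oppr_eq0; exists y.
Qed.

Lemma FR0 : FR 0.
Proof.
by apply: (sub_finite_set _ (finite_set0 X)) => x /= [y]; rewrite eqxx.
Qed.

End CfmRing.

Section CfmAlgebra.
Variables (K : comPzRingType) (X : choiceType).
Implicit Types a b : cfm K X.

Lemma cfmZ_finite (k : K) a (y : X) : finite_set [set x | k * a x y != 0].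
Proof.
apply: (sub_finite_set _ (cfm_finite a y)) => x /=.
by apply: contraNneq => ->; rewrite mulr0.
Qed.
Definition cfmZ (k : K) a := CFM (@cfmZ_finite k a).

Lemma cfmZA k l a : cfmZ k (cfmZ l a) = cfmZ (k * l) a.
Proof. by apply: cfmP => x y /=; rewrite mulrA. Qed.
Lemma cfmZ1 : left_id 1 cfmZ.
Proof. by move=> a; apply: cfmP => x y /=; rewrite mul1r. Qed.
Lemma cfmZDr : right_distributive cfmZ +%R.
Proof. by move=> k a b; apply: cfmP => x y /=; rewrite mulrDr. Qed.
Lemma cfmZDl a : {morph cfmZ^~ a : k l / k + l}.
Proof. by move=> k l; apply: cfmP => x y /=; rewrite mulrDl. Qed.

HB.instance Definition _ :=
  GRing.Zmodule_isLmodule.Build K (cfm K X) cfmZA cfmZ1 cfmZDr cfmZDl.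

Lemma cfmZE k a x y : (k *: a) x y = k * a x y. Proof. by []. Qed.

Lemma cfmZAl (k : K) a b : k *: (a * b) = (k *: a) * b.
Proof.
apply: cfmP => x y; have [A bA] := cfm_supp b y.
rewrite cfmZE !(cfm_mulE _ _ bA) mulr_sumr.
by apply: eq_bigr => z _; rewrite cfmZE mulrA.
Qed.

Lemma cfmZAr (k : K) a b : k *: (a * b) = a * (k *: b).
Proof.
apply: cfmP => x y; have [A bA] := cfm_supp b y.
rewrite cfmZE (cfm_mulE _ _ bA) mulr_sumr.
rewrite (@cfm_mulE _ _ A) => [|z /bA]; last by rewrite cfmZE => ->; rewrite mulr0.
by apply: eq_bigr => z _; rewrite cfmZE mulrCA.
Qed.

End CfmAlgebra.

(** An infinite cardinal is an infinite initial ordinal, given here as a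
    well-ordered type; the ordinal zero (the empty set) is [\bot]. *)
Definition infinite_cardinal (d : Order.disp_t) (N : bOrderType d) : Prop :=
  [/\ wochoice.well_order (fun x y : N => (x <= y)%O),
      forall x : N, ~ ([set: N] #<= [set y : N | (y < x)%O]) &
      infinite_set [set: N] ].

Section Posets.
Variables (d : Order.disp_t) (P : porderType d).

Definition is_chain (C : set P) := total_on C (fun x y => (x <= y)%O).

Record max_chain := MaxChain {
  mc_set :> set P;
  mc_chain : is_chain mc_set;
  mc_max : forall D : set P, is_chain D -> mc_set `<=` D -> D `<=` mc_set }.

Lemma max_chainP (A B : max_chain) : mc_set A = mc_set B -> A = B.
Proof.
case: A B => [A cA mA] [B cB mB] /= eAB.
by move: eAB cA mA cB mB => -> cA mA cB mB; congr MaxChain; exact: Prop_irrelevance.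
Qed.

Lemma mc_maxP (A : max_chain) (D : set P) (k : P) :
  is_chain D -> mc_set A `<=` D -> D k -> mc_set A k.
Proof. by move=> cD AD; apply: (mc_max cD AD). Qed.

HB.instance Definition _ := gen_eqMixin max_chain.
HB.instance Definition _ := gen_choiceMixin max_chain.

Definition maximal_element (i : P) := forall k : P, (i <= k)%O -> k = i.

Definition has_finite_cofinal : Prop :=
  exists2 F : set P, finite_set F & forall i : P, exists2 f, F f & (i <= f)%O.

Definition aleph_poset (d' : Order.disp_t) (aleph : bOrderType d') : Prop :=
  ([set: P] #<= [set: aleph]) /\ ([set: max_chain] #<= [set: aleph]).

Record up (i : P) := Up { up_val : P; up_le : (i <= up_val)%O }.

HB.instance Definition _ (i : P) := [isSub for @up_val i].
HB.instance Definition _ (i : P) := [Choice of up i by <:].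
HB.instance Definition _ (i : P) := [SubChoice_isSubPOrder of up i by <: with d].

End Posets.

Arguments up_val {d P i}.
Arguments max_chain {d} P.
Arguments has_finite_cofinal {d} P.
Arguments aleph_poset {d} P {d'} aleph.

Section Index.
Variables (d' : Order.disp_t) (aleph : bOrderType d').

Record fsupp (A : Type) := FSupp {
  fsupp_fun :> A -> aleph;
  fsupp_finite : finite_set [set a | fsupp_fun a != \bot%O] }.

Lemma fsuppP (A : Type) (p q : fsupp A) : (forall a, p a = q a) -> p = q.
Proof.
case: p q => [p fp] [q fq] /= /funext epq.
by move: epq fp fq => -> fp fq; congr FSupp; exact: Prop_irrelevance.
Qed.

HB.instance Definition _ (A : Type) := gen_eqMixin (fsupp A).
HB.instance Definition _ (A : Type) := gen_choiceMixin (fsupp A).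

Definition idx (d : Order.disp_t) (P : porderType d) : choiceType :=
  (fsupp P * max_chain P)%type.

Variables (d : Order.disp_t) (I : porderType d) (i : I).

Lemma restrict_finite (p : fsupp I) :
  finite_set [set k : up i | p (up_val k) != \bot%O].
Proof.
have -> : [set k : up i | p (up_val k) != \bot%O] =
    up_val @^-1` [set k | p k != \bot%O] by [].
by apply: finite_preimage (fsupp_finite p) => x y _ _; exact: val_inj.
Qed.
Definition restrict_fun (p : fsupp I) : fsupp (up i) := FSupp (restrict_finite p).

Lemma restrict_is_chain (A : max_chain I) : is_chain [set k : up i | mc_set A (up_val k)].
Proof. by move=> x y Ax Ay; have := mc_chain Ax Ay. Qed.

Lemma restrict_max (A : max_chain I) : mc_set A i ->
  forall D : set (up i), is_chain D -> [set k : up i | mc_set A (up_val k)] `<=` D ->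
  D `<=` [set k : up i | mc_set A (up_val k)].
Proof.
move=> Ai D cD AD k Dk /=.
apply: (@mc_maxP _ _ A ([set k | mc_set A k /\ (k <= i)%O] `|` [set up_val k | k in D])).
- move=> x y [[Ax xi]|[u Du <-]] [[Ay yi]|[v Dv <-]].
  + exact: mc_chain Ax Ay.
  + by left; apply: le_trans xi (up_le v).
  + by right; apply: le_trans yi (up_le u).
  + exact: (cD u v).
- move=> x Ax; have [xi|ix] := mc_chain Ax Ai; first by left.
  by right; exists (Up ix) => //; apply: AD.
- by right; exists k.
Qed.

Definition restrict_chain (A : max_chain I) (Ai : mc_set A i) : max_chain (up i) :=
  MaxChain (@restrict_is_chain A) (restrict_max Ai).

Definition idx_restrict (x : idx I) (xi : mc_set x.2 i) : idx (up i) :=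
  (restrict_fun x.1, restrict_chain xi).

(** The condition under which entry (x, y) of psi_{I,i}(a) need not vanish. *)
Definition linked (x y : idx I) : Prop :=
  [/\ mc_set x.2 i /\ mc_set y.2 i,
      mc_set x.2 `&` [set k | (k <= i)%O] = mc_set y.2 `&` [set k | (k <= i)%O] &
      forall k : I, ~~ (i <= k)%O -> x.1 k = y.1 k].

Lemma linked_l x y : linked x y -> mc_set x.2 i. Proof. by case=> [[]]. Qed.
Lemma linked_r x y : linked x y -> mc_set y.2 i. Proof. by case=> [[]]. Qed.

Lemma linked_refl x : mc_set x.2 i -> linked x x. Proof. by []. Qed.

Lemma linked_sym x y : linked x y -> linked y x.
Proof. by case=> [[xi yi] e xy]; split=> // k /xy. Qed.

Lemma linked_trans x y z : linked x y -> linked y z -> linked x z.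
Proof.
case=> [[xi yi] exy xy] [[_ zi] eyz yz]; split=> // [|k ik]; first by rewrite exy.
by rewrite xy ?yz.
Qed.

Lemma linked_le x y k : linked x y -> (k <= i)%O -> mc_set x.2 k -> mc_set y.2 k.
Proof.
case=> _ exy _ ki xk; suff [] : (mc_set y.2 `&` [set k | (k <= i)%O]) k by [].
by rewrite -exy.
Qed.

Lemma idxP (d0 : Order.disp_t) (P : porderType d0) (x y : idx P) :
  (forall k, x.1 k = y.1 k) -> mc_set x.2 `<=` mc_set y.2 -> x = y.
Proof.
case: x y => [p A] [q B] /= /fsuppP -> AB; congr pair; apply: max_chainP.
by apply/seteqP; split=> //; apply: mc_max => //; exact: mc_chain.
Qed.

(** Gluing: the part of w off {k | i <= k}, and z on it. *)
Section Glue.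
Variables (w : idx I) (wi : mc_set w.2 i).

Definition glue_fun (z : idx (up i)) (k : I) : aleph :=
  if insub k is Some u then z.1 u else w.1 k.

Lemma glue_finite z : finite_set [set k | glue_fun z k != \bot%O].
Proof.
have : finite_set ([set up_val u | u in [set u | z.1 u != \bot%O]] `|`
                   [set k | w.1 k != \bot%O]).
  rewrite finite_setU; split; last exact: fsupp_finite.
  by apply: finite_image; exact: fsupp_finite.
apply: sub_finite_set => k /=; rewrite /glue_fun.
by case: insubP => [u _ <-|_] zu; [left; exists u|right].
Qed.

Definition glue_set (z : idx (up i)) : set I :=
  [set k | mc_set w.2 k /\ (k <= i)%O] `|` [set up_val u | u in mc_set z.2].

Lemma mc_bottom (A : max_chain (up i)) : mc_set A (Up (lexx i)).
Proof.
apply: (@mc_maxP _ _ A (A `|` [set Up (lexx i)])); last by right.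
  move=> x y [Ax|->] [Ay|->]; last by left.
  - exact: mc_chain Ax Ay.
  - by right; exact: up_le.
  - by left; exact: up_le.
by move=> x; left.
Qed.

Lemma glue_chain z : is_chain (glue_set z).
Proof.
move=> x y [[wx xi]|[u zu <-]] [[wy yi]|[v zv <-]].
- exact: mc_chain wx wy.
- by left; exact: le_trans xi (up_le v).
- by right; exact: le_trans yi (up_le u).
- exact: (mc_chain zu zv).
Qed.

Lemma glue_max z (D : set I) : is_chain D -> glue_set z `<=` D ->
  D `<=` glue_set z.
Proof.
move=> cD zD k Dk; have Di : D i by apply: zD; left.
have [ki|ik] := cD _ _ Dk Di; [left|right].
  split=> //.
  apply: (@mc_maxP _ _ w.2 ([set k | D k /\ (k <= i)%O] `|`
                          [set k | mc_set w.2 k /\ (i <= k)%O])); last by left.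
    move=> x y [[Dx xi]|[wx ix]] [[Dy yi]|[wy iy]].
    - exact: cD Dx Dy.
    - by left; exact: le_trans xi iy.
    - by right; exact: le_trans yi ix.
    - exact: mc_chain wx wy.
  move=> x wx; have [xi|ix] := mc_chain wx wi; last by right.
  by left; split=> //; apply: zD; left.
exists (Up ik) => //.
apply: (@mc_maxP _ _ z.2 [set u : up i | D (up_val u)]) => //.
  by move=> x y Dx Dy; exact: (cD _ _ Dx Dy).
by move=> x zx; apply: zD; right; exists x.
Qed.

Definition idx_glue (z : idx (up i)) : idx I :=
  (FSupp (glue_finite z), MaxChain (@glue_chain z) (@glue_max z)).

Lemma glueT z k (ik : (i <= k)%O) : (idx_glue z).1 k = z.1 (Up ik).
Proof.
rewrite /= /glue_fun; case: insubP => [u _ ek|]; last by rewrite ik.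
by congr (z.1 _); apply: val_inj.
Qed.

Lemma glueF z k : ~~ (i <= k)%O -> (idx_glue z).1 k = w.1 k.
Proof.
by rewrite /= /glue_fun; case: insubP => [u -> //|].
Qed.

Lemma glue_up z k (ik : (i <= k)%O) : mc_set (idx_glue z).2 k <-> mc_set z.2 (Up ik).
Proof.
split=> [[[wk ki]|[u zu eu]]|zk].
- have eki : k = i by apply/le_anti/andP.
  by subst k; rewrite (_ : Up ik = Up (lexx i)); [exact: mc_bottom|exact: val_inj].
- by rewrite (_ : Up ik = u) //; exact: val_inj.
- by right; exists (Up ik).
Qed.

Lemma glue_not_up z k : ~~ (i <= k)%O ->
  mc_set (idx_glue z).2 k <-> mc_set w.2 k /\ (k <= i)%O.
Proof.
move=> nik; split=> [[//|[u _ eu]]|wk]; last by left.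
by move: nik; rewrite -eu; have -> := up_le u.
Qed.

Lemma glue_i z : mc_set (idx_glue z).2 i. Proof. by left. Qed.

Lemma glue_linked z : linked w (idx_glue z).
Proof.
split=> [|| k ik]; last by rewrite glueF.
  by split=> //; exact: glue_i.
apply/seteqP; split=> k [wk ki]; split=> //; first by left.
have [ik|nik] := boolP (i <= k)%O; last by have /(glue_not_up z nik)[] := wk.
by rewrite (_ : k = i) //; apply/le_anti/andP.
Qed.

Lemma glueK z (h : mc_set (idx_glue z).2 i) : idx_restrict h = z.
Proof.
apply: idxP => [k|k /=].
  rewrite /idx_restrict; set t := (X in X.1) => /=; rewrite {}/t.
  change ((idx_glue z).1 (up_val k) = z.1 k).
  by rewrite (glueT _ (up_le k)); congr (z.1 _); exact: val_inj.
move=> /(glue_up z (up_le k)).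
by rewrite (_ : Up _ = k) //; exact: val_inj.
Qed.

Lemma restrictK x (h : mc_set x.2 i) : linked w x -> idx_glue (idx_restrict h) = x.
Proof.
move=> lwx; apply: idxP => [k|k].
  have [ik|nik] := boolP (i <= k)%O; first by rewrite (glueT _ ik).
  by rewrite glueF //; case: lwx => _ _ ->.
have [ik|nik] := boolP (i <= k)%O; first by move=> /(glue_up _ ik).
by move=> /(glue_not_up _ nik)[wk ki]; exact: linked_le lwx _ wk.
Qed.

Lemma glue_inj : injective idx_glue.
Proof. by move=> u v e; rewrite -(glueK (glue_i u)); move: (glue_i u); rewrite e => h; rewrite glueK. Qed.

End Glue.

Lemma restrict_irr (x y : idx I) (h : mc_set x.2 i) (h' : mc_set y.2 i) :
  x = y -> idx_restrict h = idx_restrict h'.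
Proof. by move=> e; subst y; rewrite (Prop_irrelevance h h'). Qed.

Lemma restrict_inj (x y : idx I) (h : mc_set x.2 i) (h' : mc_set y.2 i) :
  linked x y -> idx_restrict h = idx_restrict h' -> x = y.
Proof.
move=> l e; rewrite -(restrictK h h (linked_refl h)) e.
by rewrite restrictK.
Qed.

End Index.

Section Psi.
Variables (d' : Order.disp_t) (aleph : bOrderType d') (K : fieldType).
Variables (d : Order.disp_t) (I : porderType d).

Definition Qalg := cfm K (idx aleph I).

Section At.
Variable i : I.

Definition psi_fun (a : cfm K (idx aleph (up i))) (x y : idx aleph I) : K :=
  match pselect (linked i x y) with
  | left l => a (idx_restrict (linked_l l)) (idx_restrict (linked_r l))
  | right _ => 0
  end.

Lemma psi_finite a y : finite_set [set x | psi_fun a x y != 0].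
Proof.
have [yi|nyi] := pselect (mc_set y.2 i); last first.
  apply: (sub_finite_set _ (finite_set0 (idx aleph I))) => x /=.
  rewrite /psi_fun; case: pselect => [/linked_r //|_]; by rewrite eqxx.
have := finite_image (idx_glue yi) (cfm_finite a (idx_restrict yi)).
apply: sub_finite_set => x /=; rewrite /psi_fun.
case: pselect => [l|_]; last by rewrite eqxx.
rewrite (restrict_irr (linked_r l) yi erefl) => ax.
by exists (idx_restrict (linked_l l)) => //; apply: restrictK; apply: linked_sym.
Qed.

Definition psi (a : cfm K (idx aleph (up i))) : Qalg := CFM (@psi_finite a).

Lemma psiE a x y (xi : mc_set x.2 i) (yi : mc_set y.2 i) : linked i x y ->
  psi a x y = a (idx_restrict xi) (idx_restrict yi).
Proof.
move=> lxy; rewrite /= /psi_fun; case: pselect => // l.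
by congr (cfm_fun a _ _); exact: restrict_irr.
Qed.

Lemma psi_eq0 a x y : ~ linked i x y -> psi a x y = 0.
Proof. by move=> nl; rewrite /= /psi_fun; case: pselect. Qed.

Lemma psi_neq0 a x y : psi a x y != 0 -> linked i x y.
Proof. by move=> nz; apply: contrapT => /(psi_eq0 a) e; rewrite e eqxx in nz. Qed.

Lemma psiN a : psi (- a) = - psi a.
Proof.
apply: cfmP => x y; rewrite cfmNE /= /psi_fun.
by case: pselect => // _; rewrite oppr0.
Qed.

Lemma psi0 : psi 0 = 0.
Proof. by apply: cfmP => x y; rewrite /= /psi_fun; case: pselect. Qed.

Lemma psiZ (c : K) a : psi (c *: a) = c *: psi a.
Proof.
apply: cfmP => x y; rewrite cfmZE /= /psi_fun.
by case: pselect => // _; rewrite mulr0.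
Qed.

Lemma psi1E x y : psi 1 x y = ((x == y) && `[< mc_set x.2 i >])%:R.
Proof.
have [<-|nxy] := eqVneq x y; last first.
  rewrite /= /psi_fun; case: pselect => // l; rewrite cfm1E; case: eqVneq => // e.
  by case/eqP: nxy; exact: restrict_inj l e.
case: asboolP => xi; first by rewrite (psiE 1 xi xi) // cfm1E eqxx.
by rewrite psi_eq0 // => /linked_l.
Qed.

Definition Hel : set Qalg :=
  if `[< maximal_element i >] then [set c *: psi 1 | c in [set: K]]
  else psi @` @FR K (idx aleph (up i)).

Lemma Hel_psi m : Hel m -> exists a, m = psi a.
Proof.
rewrite /Hel; case: ifP => _ [a _ <-]; last by exists a.
by exists (a *: (1 : cfm K (idx aleph (up i)))); rewrite psiZ.
Qed.

Lemma HelN m : Hel m -> Hel (- m).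
Proof.
rewrite /Hel; case: ifP => _ [a Fa <-].
  by exists (- a) => //; rewrite scaleNr.
by exists (- a); rewrite ?psiN //; exact: FRN.
Qed.

Lemma Hel0 : Hel 0.
Proof.
rewrite /Hel; case: ifP => _; first by exists 0; rewrite ?scale0r.
by exists 0; rewrite ?psi0 //; exact: FR0.
Qed.

Lemma Hel_neq0 m x y : Hel m -> m x y != 0 -> linked i x y.
Proof. by case/Hel_psi => a ->; exact: psi_neq0. Qed.

(** The matrices that act on each class of linked indices, in the same way on
    all of them; every psi_{I,j}(b) with i <= j is one. *)
Definition local_at (m : Qalg) : Prop :=
  (forall x y, m x y != 0 -> mc_set x.2 i \/ mc_set y.2 i -> linked i x y) /\
  (forall w w' (wi : mc_set w.2 i) (wi' : mc_set w'.2 i) u v,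
     m (idx_glue wi u) (idx_glue wi v) = m (idx_glue wi' u) (idx_glue wi' v)).

Lemma compress_finite (m : Qalg) w (wi : mc_set w.2 i) v :
  finite_set [set u | m (idx_glue wi u) (idx_glue wi v) != 0].
Proof.
apply: (finite_preimage _ (cfm_finite m (idx_glue wi v))) => x y _ _.
exact: glue_inj.
Qed.
Definition compress (m : Qalg) w (wi : mc_set w.2 i) : cfm K (idx aleph (up i)) :=
  CFM (compress_finite m wi).

Lemma compress_psi a w (wi : mc_set w.2 i) : compress (psi a) wi = a.
Proof.
apply: cfmP => u v.
change (psi a (idx_glue wi u) (idx_glue wi v) = a u v).
rewrite (psiE a (glue_i wi u) (glue_i wi v)) ?glueK //.
exact: linked_trans (linked_sym (glue_linked wi u)) (glue_linked wi v).
Qed.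

Lemma compressM m m' w (wi : mc_set w.2 i) : local_at m ->
  compress (m * m') wi = compress m wi * compress m' wi.
Proof.
move=> [mi _]; apply: cfmP => u v.
change ((m * m') (idx_glue wi u) (idx_glue wi v) =
        (compress m wi * compress m' wi) u v).
rewrite !cfmME -(fsbig_image setT (idx_glue wi)
  (fun z => m (idx_glue wi u) z * m' z (idx_glue wi v))); last first.
  by move=> x y _ _; exact: glue_inj.
apply/esym/fsbig_widen => // z [_ nz] /=; apply/eqP; apply: contra_notT nz => nz.
have mz : m (idx_glue wi u) z != 0 by apply: contraNneq nz => ->; rewrite mul0r.
have l := mi _ _ mz (or_introl (glue_i wi u)).
exists (idx_restrict (linked_r l)) => //; apply: restrictK.
exact: linked_trans (glue_linked wi u) l.
Qed.

Lemma psi_compress m w (wi : mc_set w.2 i) : local_at m ->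
  (forall x y, m x y != 0 -> mc_set x.2 i) -> psi (compress m wi) = m.
Proof.
move=> [mi mloc] mx; apply: cfmP => x y.
have [l|nl] := pselect (linked i x y).
  have xi := linked_l l; have yi := linked_r l.
  rewrite (psiE _ xi yi l).
  change (m (idx_glue wi (idx_restrict xi)) (idx_glue wi (idx_restrict yi)) = m x y).
  by rewrite (mloc _ _ wi xi) !restrictK.
rewrite psi_eq0 //; apply/esym/eqP; apply: contra_notT nl => nz.
by apply: mi => //; left; exact: mx nz.
Qed.

Lemma local_atM m m' : local_at m -> local_at m' -> local_at (m * m').
Proof.
move=> lm lm'; have [mi mloc] := lm; have [mi' mloc'] := lm'; split.
  move=> x y /cfm_mul_neq0[z mz m'z] [xi|yi].
    have l := mi _ _ mz (or_introl xi).
    exact: linked_trans l (mi' _ _ m'z (or_introl (linked_r l))).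
  have l := mi' _ _ m'z (or_intror yi).
  exact: linked_trans (mi _ _ mz (or_intror (linked_l l))) l.
move=> w w' wi wi' u v.
change (compress (m * m') wi u v = compress (m * m') wi' u v).
rewrite !compressM // !cfmME; apply: eq_fsbigr => z _ /=.
by rewrite (mloc _ _ wi wi') (mloc' _ _ wi wi').
Qed.

End At.

Lemma linked_weaken (i j : I) (x y : idx aleph I) : (i <= j)%O ->
  linked j x y -> mc_set x.2 i -> linked i x y.
Proof.
move=> ij l xi; have yi := linked_le l ij xi.
have [_ _ lxy] := l; split=> [//||k nik].
  apply/seteqP; split=> k [xk ki]; split=> //.
    exact: linked_le l (le_trans ki ij) xk.
  exact: linked_le (linked_sym l) (le_trans ki ij) xk.
by apply: lxy; apply: contra nik; exact: le_trans.
Qed.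

Lemma linked_glue (i j : I) (ij : (i <= j)%O) (w w' : idx aleph I)
    (wi : mc_set w.2 i) (wi' : mc_set w'.2 i) u v :
  linked j (idx_glue wi u) (idx_glue wi v) -> linked j (idx_glue wi' u) (idx_glue wi' v).
Proof.
case=> [[uj vj] euv luv].
have gl t : mc_set (idx_glue wi t).2 j -> mc_set (idx_glue wi' t).2 j.
  by move=> /(glue_up wi t ij) tj; apply/(glue_up wi' t ij).
split; first by split; exact: gl.
- have le u' v' k : (k <= j)%O ->
      (mc_set (idx_glue wi u').2 k -> mc_set (idx_glue wi v').2 k) ->
      mc_set (idx_glue wi' u').2 k -> mc_set (idx_glue wi' v').2 k.
    move=> kj h; have [ik|nik] := boolP (i <= k)%O.
      move=> /(glue_up wi' u' ik)/(glue_up wi u' ik)/h/(glue_up wi v' ik) ?.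
      exact/(glue_up wi' v' ik).
    by move=> /(glue_not_up wi' u' nik) ?; exact/(glue_not_up wi' v' nik).
  have lk k : (k <= j)%O -> mc_set (idx_glue wi u).2 k <-> mc_set (idx_glue wi v).2 k.
    move=> kj; split=> h.
      suff [] : (mc_set (idx_glue wi v).2 `&` [set k | (k <= j)%O]) k by [].
      by rewrite -euv.
    suff [] : (mc_set (idx_glue wi u).2 `&` [set k | (k <= j)%O]) k by [].
    by rewrite euv.
  apply/seteqP; split=> k [gk kj]; split=> //; move: gk; apply: le => //.
    by move/(lk k kj).
  by move/(lk k kj).
- move=> k njk; have := luv k njk.
  have [ik|nik] := boolP (i <= k)%O; first by rewrite !(glueT _ _ ik).
  by rewrite !glueF.
Qed.

Lemma local_psi (i j : I) b : (i <= j)%O -> local_at i (psi (i := j) b).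
Proof.
move=> ij; split=> [x y /psi_neq0 l [xi|yi]|w w' wi wi' u v].
- exact: linked_weaken l xi.
- exact/linked_sym/(linked_weaken ij (linked_sym l) yi).
have [l|nl] := pselect (linked j (idx_glue wi u) (idx_glue wi v)); last first.
  rewrite !psi_eq0 // => l; apply: nl; exact: linked_glue l.
have l' := linked_glue ij wi' l.
have gE t (h : mc_set (idx_glue wi t).2 j) (h' : mc_set (idx_glue wi' t).2 j) :
    idx_restrict h = idx_restrict h'.
  apply: idxP => k.
    change ((idx_glue wi t).1 (up_val k) = (idx_glue wi' t).1 (up_val k)).
    by rewrite !(glueT _ _ (le_trans ij (up_le k))).
  change (mc_set (idx_glue wi t).2 (up_val k) -> mc_set (idx_glue wi' t).2 (up_val k)).
  have ik := le_trans ij (up_le k).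
  by move=> /(glue_up wi t ik) ?; apply/(glue_up wi' t ik).
rewrite (psiE _ (linked_l l) (linked_r l) l).
rewrite (psiE _ (linked_l l') (linked_r l') l').
by congr (cfm_fun b _ _); exact: gE.
Qed.

Lemma HelM_le (i j : I) (m m' : Qalg) : (i <= j)%O -> Hel i m -> Hel j m' ->
  Hel i (m * m') /\ Hel i (m' * m).
Proof.
move=> ij Hm Hm'; have [a ea] := Hel_psi Hm; have [b eb] := Hel_psi Hm'.
have [[w wi]|nw] := pselect (exists w : idx aleph I, mc_set w.2 i); last first.
  have m0 : m = 0.
    apply: cfmP => x y; rewrite ea psi_eq0 // => /linked_l xi.
    by apply: nw; exists x.
  by rewrite m0 mul0r mulr0; split; exact: Hel0.
have lm : local_at i m by rewrite ea; exact: local_psi.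
have lm' : local_at i m' by rewrite eb; exact: local_psi.
have ca : compress m wi = a by rewrite ea compress_psi.
have -> : m * m' = psi (a * compress m' wi).
  rewrite -[in RHS]ca -compressM // psi_compress //; first exact: local_atM.
  by move=> x y /cfm_mul_neq0[z /(Hel_neq0 Hm)/linked_l].
have -> : m' * m = psi (compress m' wi * a).
  rewrite -[in RHS]ca -compressM // psi_compress //; first exact: local_atM.
  move=> x y /cfm_mul_neq0[z m'z /(Hel_neq0 Hm)/linked_l zi].
  by have [/(_ _ _ m'z (or_intror zi))/linked_l] := lm'.
move: Hm; rewrite /Hel; case: asboolP => [maxi [c _ ec]|_ [a' Fa' ea']].
  have eji := maxi _ ij; subst j.
  move: Hm'; rewrite /Hel asboolT // => -[c' _ ec'].
  pose e : cfm K (idx aleph (up i)) := 1.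
  have -> : a = c *: e by rewrite -ca -ec -psiZ compress_psi.
  have -> : compress m' wi = c' *: e by rewrite -ec' -psiZ compress_psi.
  have e1 : (c *: e) * (c' *: e) = (c * c') *: e.
    by rewrite -cfmZAl mul1r scalerA.
  have e2 : (c' *: e) * (c *: e) = (c' * c) *: e.
    by rewrite -cfmZAl mul1r scalerA.
  rewrite e1 e2 !psiZ; split; first by exists (c * c').
  by exists (c' * c).
have Fa : FR a by rewrite -ca -ea' compress_psi.
split; first by exists (a * compress m' wi) => //; exact: FRM.
by exists (compress m' wi * a) => //; exact: FRMr.
Qed.

Lemma HelM (i j : I) (m m' : Qalg) : Hel i m -> Hel j m' ->
  Hel i (m * m') \/ Hel j (m * m').
Proof.
move=> Hm Hm'.
have [ij|nij] := boolP (i <= j)%O; first by left; case: (HelM_le ij Hm Hm').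
have [ji|nji] := boolP (j <= i)%O; first by right; case: (HelM_le ji Hm' Hm).
suff -> : m * m' = 0 by left; exact: Hel0.
apply: cfmP => x y; apply/eqP; apply/negP => /negP /cfm_mul_neq0[z].
move=> /(Hel_neq0 Hm)/linked_r zi /(Hel_neq0 Hm')/linked_l zj.
by have [] := mc_chain zi zj; rewrite ?(negbTE nij) ?(negbTE nji).
Qed.

(** Sums over J are finite sums of elements of the subgroups [Hel j], j in J. *)
Definition Hsum (J : set I) : set Qalg :=
  [set m | exists2 s : seq Qalg,
     (forall h, h \in s -> exists2 j, J j & Hel j h) & m = \sum_(h <- s) h].

Lemma Hel_Hsum (J : set I) j m : J j -> Hel j m -> Hsum J m.
Proof.
move=> Jj Hm; exists [:: m]; last by rewrite big_seq1.
by move=> h; rewrite inE => /eqP->; exists j.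
Qed.

Lemma Hsum0 J : Hsum J 0.
Proof. by exists [::]; rewrite ?big_nil. Qed.

Lemma HsumD J m m' : Hsum J m -> Hsum J m' -> Hsum J (m + m').
Proof.
move=> [s Hs ->] [t Ht ->]; exists (s ++ t); last by rewrite big_cat.
by move=> h; rewrite mem_cat => /orP[/Hs|/Ht].
Qed.

Lemma HsumN J m : Hsum J m -> Hsum J (- m).
Proof.
move=> [s Hs ->]; exists [seq - h | h <- s]; last by rewrite big_map sumrN.
by move=> h /mapP[h' /Hs[j Jj Hh'] ->]; exists j => //; exact: HelN.
Qed.

Lemma Hsum_sum (J : set I) (T : eqType) (r : seq T) (F : T -> Qalg) :
  (forall t, t \in r -> Hsum J (F t)) -> Hsum J (\sum_(t <- r) F t).
Proof.
move=> JF; rewrite big_seq; apply: big_rec => [|t m tr]; first exact: Hsum0.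
by apply: HsumD; exact: JF.
Qed.

Lemma HsumM J m m' : Hsum J m -> Hsum J m' -> Hsum J (m * m').
Proof.
move=> [s Hs ->] [t Ht ->]; rewrite mulr_suml.
apply: Hsum_sum => h /Hs[i Ji Hh]; rewrite mulr_sumr.
apply: Hsum_sum => h' /Ht[j Jj Hh'].
by have [] := HelM Hh Hh'; exact: Hel_Hsum.
Qed.

Lemma Hsum_zmod_closed J : zmod_closed (mem (Hsum J)).
Proof.
split=> [|x y]; rewrite !inE; first exact: Hsum0.
by move=> Jx Jy; apply: HsumD => //; exact: HsumN.
Qed.

Definition maximal_elements : set I := [set i | maximal_element i].

Definition Bunit : Qalg := \sum_(i \in maximal_elements) psi (i := i) 1.

Lemma maximal_finite : has_finite_cofinal I -> finite_set maximal_elements.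
Proof.
move=> [F fF cF]; apply: (sub_finite_set _ fF) => i maxi.
by have [f Ff /maxi <-] := cF i.
Qed.

Lemma maximal_in_chain (A : max_chain I) : has_finite_cofinal I -> inhabited I ->
  exists2 i, maximal_element i & mc_set A i.
Proof.
move=> [F /finite_seqP[s eF] cF] [i0].
have ubA : exists f : I, forall a, mc_set A a -> (a <= f)%O.
  have [[a Aa]|nA] := pselect (exists a, mc_set A a); last first.
    by exists i0 => a Aa; case: nA; exists a.
  suff [[f _ uf]|[b Ab nb]] : (exists2 f, f \in s &
        forall a, mc_set A a -> (a <= f)%O) \/
      (exists2 b, mc_set A b & forall f, f \in s -> ~~ (b <= f)%O).
  - by exists f.
  - have [f] := cF b; rewrite eF /= => /nb nbf bf.
    by rewrite bf in nbf.
  elim: s {eF F cF} => [|f s [[g gs ug]|[b Ab nb]]]; first by right; exists a.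
    by left; exists g => //; rewrite inE gs orbT.
  have [uf|] := pselect (forall a, mc_set A a -> (a <= f)%O).
    by left; exists f => //; rewrite inE eqxx.
  move=> /existsNP[c /not_implyP[Ac /negP ncf]]; right.
  have [bc|cb] := mc_chain Ab Ac.
    exists c => // g; rewrite inE => /orP[/eqP-> //|/nb].
    by apply: contra; exact: le_trans.
  exists b => // g; rewrite inE => /orP[/eqP->|/nb //].
  by apply: contra ncf; exact: le_trans.
have [f uf] := ubA.
have Ak k : (f <= k)%O -> mc_set A k.
  move=> fk; apply: (@mc_maxP _ _ A (mc_set A `|` [set k])); last by right.
    move=> x y [Ax|->] [Ay|->]; last by left.
    - exact: mc_chain Ax Ay.
    - by left; exact: le_trans (uf _ Ax) fk.
    - by right; exact: le_trans (uf _ Ay) fk.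
  by move=> x; left.
exists f; last exact: Ak.
by move=> k fk; apply/le_anti; rewrite fk (uf _ (Ak _ fk)).
Qed.

Lemma Bunit_Hsum : has_finite_cofinal I -> Hsum setT Bunit.
Proof.
move=> /maximal_finite fM; rewrite /Bunit fsbig_finite //.
apply: Hsum_sum => i; rewrite in_fset_set // inE => maxi.
apply: (@Hel_Hsum _ i) => //; rewrite /Hel asboolT //.
by exists 1; rewrite ?scale1r.
Qed.

Lemma BunitE : has_finite_cofinal I -> inhabited I -> Bunit = 1.
Proof.
move=> hI I0; have fM := maximal_finite hI.
apply: cfmP => x y; rewrite /Bunit fsbig_finite // cfm_sumE cfm1E.
under eq_bigr do rewrite psi1E.
have [_|_] := eqVneq x y; last by rewrite big1.
have [i maxi xi] := maximal_in_chain x.2 hI I0.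
rewrite (big_fsetD1 i) /=; last by rewrite in_fset_set // inE.
rewrite asboolT // big_seq big1 ?addr0 // => j.
rewrite !inE => /andP[/eqP nji]; rewrite in_fset_set // inE => maxj.
rewrite asboolF // => xj; apply: nji.
by have [/maxi|/maxj] := mc_chain xi xj.
Qed.

Lemma BunitM m : has_finite_cofinal I -> Hsum setT m -> Bunit * m = m.
Proof.
move=> hI [s Hs ->]; have [I0|nI] := pselect (inhabited I).
  by rewrite BunitE // mul1r.
rewrite big_seq big1 ?mulr0 // => h /Hs[j].
by case: nI.
Qed.

Lemma BunitMr m : has_finite_cofinal I -> Hsum setT m -> m * Bunit = m.
Proof.
move=> hI [s Hs ->]; have [I0|nI] := pselect (inhabited I).
  by rewrite BunitE // mulr1.
rewrite big_seq big1 ?mul0r // => h /Hs[j].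
by case: nI.
Qed.

End Psi.

Section BRing.
Variables (d' : Order.disp_t) (aleph : bOrderType d') (K : fieldType).
Variables (d : Order.disp_t) (I : porderType d).

(** B(I) = H(I, I), whose unit is Bunit: it is the unit of Q(I), except that
    B(I) = 0 when I is empty. The phantom argument hI gives access to the proof that B(I) is unital. *)
Record Balg (hI : has_finite_cofinal I) := MkB {
  B_val : Qalg aleph K I;
  B_in : B_val \in Hsum [set: I] }.

Variable hI : has_finite_cofinal I.
Local Notation B := (Balg hI).

HB.instance Definition _ := [isSub for @B_val hI].
HB.instance Definition _ := [Choice of B by <:].
HB.instance Definition _ :=
  GRing.SubChoice_isSubZmodule.Build (Qalg aleph K I) (mem (Hsum [set: I])) B
    (Hsum_zmod_closed aleph K [set: I]).

Lemma B_valP (b : B) : Hsum [set: I] (B_val b).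
Proof. exact: set_mem (B_in b). Qed.

Definition B_one : B := MkB hI (mem_set (Bunit_Hsum aleph K hI)).
Definition B_mul (a b : B) : B := MkB hI (mem_set (HsumM (B_valP a) (B_valP b))).

Lemma B_mulA : associative B_mul.
Proof. by move=> a b c; apply: val_inj; rewrite /= mulrA. Qed.
Lemma B_mul1 : left_id B_one B_mul.
Proof. by move=> a; apply: val_inj; exact: BunitM (B_valP a). Qed.
Lemma B_1mul : right_id B_one B_mul.
Proof. by move=> a; apply: val_inj; exact: BunitMr (B_valP a). Qed.
Lemma B_mulDl : left_distributive B_mul +%R.
Proof. by move=> a b c; apply: val_inj; exact: mulrDl. Qed.
Lemma B_mulDr : right_distributive B_mul +%R.
Proof. by move=> a b c; apply: val_inj; exact: mulrDr. Qed.

HB.instance Definition _ :=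
  GRing.Zmodule_isPzRing.Build B B_mulA B_mul1 B_1mul B_mulDl B_mulDr.

Lemma B_valM (a b : B) : B_val (a * b) = B_val a * B_val b.
Proof. by []. Qed.
Lemma B_val1 : inhabited I -> B_val (1 : B) = 1.
Proof. exact: BunitE. Qed.

Definition H_in_B (J : set I) : set B := [set b | Hsum J (B_val b)].

Definition not_above (A : set I) : set I :=
  ~` [set k | exists2 a, A a & (a <= k)%O].

End BRing.

Arguments Balg {d'} aleph K {d I} hI.
Arguments H_in_B {d'} aleph K {d I} hI J.

Definition simple_module (R : pzRingType) (V : lmodType R) : Prop :=
  (exists v : V, v != 0) /\
  forall W : {pred V}, submod_closed W -> W =i pred1 0 \/ W =i predT.

Definition annihilator (R : pzRingType) (V : lmodType R) : set R :=
  [set r | forall v : V, r *: v = 0].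

Definition left_primitive (R : pzRingType) (P : set R) : Prop :=
  exists V : lmodType R, simple_module V /\ P = annihilator V.

(** Right R-modules are the left modules over the converse ring R^c. *)
Definition right_primitive (R : pzRingType) (P : set R) : Prop :=
  exists V : lmodType R^c, simple_module V /\ P = annihilator V.

(* Main.v *)
From HB Require Import structures.
Require Import Defs.
From mathcomp Require Import all_boot all_order all_algebra finmap.
From mathcomp Require Import boolp classical_sets cardinality fsbigop.

Set Implicit Arguments.
Unset Strict Implicit.
Unset Printing Implicit Defensive.

Import Order.TTheory GRing.Theory.

Local Open Scope classical_set_scope.
Local Open Scope ring_scope.

(** For a nonempty chain A, project B(I) onto the sum of the H(I, i), i above
    some element of A, and let it act by matrix multiplication. Fix an index x0
    whose maximal chain contains A. The columns, resp. rows, supported on the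
    indices linked to x0 at some a in A form a simple left, resp. right, module
    (replaced by a line if the least element of A is maximal in I). Its
    annihilator is H(I, {A not <=}) since aleph is infinite: away from finitely
    many coordinate values the pieces H(I, j) with j < k do not interfere with
    H(I, k).

    Conversely let P annihilate a simple module V, and let v be nonzero in V.
    A maximal chain A among the indices i with H(I, i) v <> 0 is coinitial among
    the i with H(I, i) V <> 0, so P contains H(I, {A not <=}). The inclusion is
    an equality, because for a in A every nonzero element of the sum of the
    H(I, k), k >= a, generates an ideal that contains H(I, a). *)

(** * Chains and maximal chains in a poset *)

Section Chains.
Variables (d : Order.disp_t) (P : porderType d).

Lemma chain_maximal_in (T D : set P) : is_chain D -> D `<=` T ->
  exists C, [/\ is_chain C, D `<=` C, C `<=` T &
    forall C', is_chain C' -> C `<=` C' -> C' `<=` T -> C' `<=` C].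
Proof.
move=> cD DT.
(* Zorn's lemma also asks for the union of the empty family, which need not contain [D]; hence [D]
   is joined to [C] in the condition instead of being required inside [C]. *)
have [|C [[cC CT] maxC]] := @Zorn_bigcup P
    [set C | is_chain (D `|` C) /\ C `<=` T].
  move=> F FT cF; split=> [x y|x [X /FT[_ XT] /XT //]].
  have FP X : F X -> is_chain (D `|` X) by move=> /FT[].
  move=> [Dx|[X FX Xx]] [Dy|[Y FY Yy]].
  - exact: cD.
  - by apply: (FP _ FY); [left|right].
  - by apply: (FP _ FX); [right|left].
  - have [XY|YX] := cF _ _ FX FY.
      by apply: (FP _ FY); right => //; exact: XY.
    by apply: (FP _ FX); right => //; exact: YX.
exists (D `|` C); split=> //.
  by move=> x [/DT|/CT].
move=> C' cC' DCC' C'T x C'x; right; apply: contrapT => nCx.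
apply: (maxC C'); first by split=> [y Cy|/(_ _ C'x)//]; apply: DCC'; right.
split=> //; suff -> : D `|` C' = C' by [].
by apply/seteqP; split=> y; [case=> // Dy; apply: DCC'; left|right].
Qed.

Lemma max_chain_exists (D : set P) : is_chain D ->
  exists C : max_chain P, D `<=` mc_set C.
Proof.
move=> cD; have [C [cC DC _ mC]] := chain_maximal_in cD (@subsetT _ D).
by exists (MaxChain cC (fun C' c s => mC C' c s (@subsetT _ C'))).
Qed.

Lemma is_chain1 (i : P) : is_chain [set i].
Proof. by move=> x y -> ->; left. Qed.

(** Finitely many witnesses in a chain have a least one, and [R t] passes to smaller elements. An
    empty [s] takes its witness from [C !=set0]. *)
Lemma chain_lower_bound (C : set P) (T : eqType) (s : seq T) (R : T -> P -> Prop) :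
  is_chain C -> C !=set0 ->
  (forall t x y, (y <= x)%O -> R t x -> R t y) ->
  (forall t, t \in s -> exists2 c, C c & R t c) ->
  exists2 c, C c & forall t, t \in s -> R t c.
Proof.
move=> cC [c0 Cc0] Rmono; elim: s => [|t s IHs] sC; first by exists c0.
have [|c Cc cs] := IHs; first by move=> u us; apply: sC; rewrite inE us orbT.
have [|e Ce te] := sC t; first by rewrite inE eqxx.
have [ce|ec] := cC c e Cc Ce.
  exists c => // u; rewrite inE => /orP[/eqP->|/cs //]; exact: Rmono ce te.
exists e => // u; rewrite inE => /orP[/eqP-> //|/cs]; exact: Rmono.
Qed.

Lemma seq_maximal (s : seq P) (x0 : P) : x0 \in s ->
  exists2 x, x \in s & forall y, y \in s -> (x <= y)%O -> y = x.
Proof.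
elim: s x0 => // z s IHs x0 _.
have [->|] := eqVneq s [::].
  by exists z; rewrite ?inE // => y; rewrite inE => /eqP.
case: s IHs => // z' s IHs _; have [|x xs maxx] := IHs z'.
  by rewrite inE eqxx.
have [xz|nxz] := boolP (x <= z)%O.
  exists z; first by rewrite inE eqxx.
  move=> y; rewrite inE => /orP[/eqP//|ys zy].
  have yx := maxx y ys (le_trans xz zy); subst y.
  by apply/le_anti; rewrite xz zy.
exists x; first by rewrite inE xs orbT.
move=> y; rewrite inE => /orP[/eqP-> xz|/maxx //].
by rewrite xz in nxz.
Qed.

End Chains.

(** * Simple modules from transitive actions *)

(** Transitivity on nonzero vectors gives simplicity and also the unit law, which is therefore not a
    field. The vectors form a subset of an ambient group because they will be matrices of a
    prescribed support. *)
Record transitive_action (R : pzRingType) := TransitiveAction {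
  ta_amb : zmodType;
  ta_set : set ta_amb;
  ta_act : R -> ta_amb -> ta_amb;
  ta_zmod : zmod_closed (mem ta_set);
  ta_stable : forall r v, ta_set v -> ta_set (ta_act r v);
  ta_actDl : forall r s v, ta_act (r + s) v = ta_act r v + ta_act s v;
  ta_actDr : forall r v w, ta_act r (v + w) = ta_act r v + ta_act r w;
  ta_actM : forall r s v, ta_set v -> ta_act r (ta_act s v) = ta_act (r * s) v;
  ta_trans : forall v w, ta_set v -> ta_set w -> v != 0 ->
    exists r, ta_act r v = w;
  ta_neq0 : exists2 v, ta_set v & v != 0 }.

Arguments ta_set {R} t.
Arguments ta_act {R} t.

Section ActionModule.
Variables (R : pzRingType) (D : transitive_action R).

Record action_module := ActionModule {
  am_val : ta_amb D; am_in : am_val \in ta_set D }.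

HB.instance Definition _ := [isSub for am_val].
HB.instance Definition _ := [Choice of action_module by <:].
HB.instance Definition _ :=
  GRing.SubChoice_isSubZmodule.Build (ta_amb D) (mem (ta_set D)) action_module
    (ta_zmod D).

Definition am_scale (r : R) (v : action_module) : action_module :=
  ActionModule (mem_set (ta_stable r (set_mem (am_in v)))).

Lemma am_scaleA r s v : am_scale r (am_scale s v) = am_scale (r * s) v.
Proof. by apply: val_inj; apply: ta_actM; exact: set_mem (am_in v). Qed.

(* [1] acts as an idempotent commuting with the action, and [v = r v] for some
   [r] by transitivity, so that [1 v = 1 (r v) = r v = v]. *)
Lemma am_scale1 : left_id 1 am_scale.
Proof.
move=> v; have Sv := set_mem (am_in v).
have [v0|nv0] := eqVneq (am_val v) 0.
  apply: val_inj; rewrite /= v0; apply: (addrI (ta_act D 1 0)).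
  by rewrite -ta_actDr !addr0.
have [r rv] := ta_trans Sv Sv nv0; have -> : v = am_scale r v by exact: val_inj.
by rewrite am_scaleA mul1r.
Qed.

Lemma am_scaleDr : right_distributive am_scale +%R.
Proof. by move=> r v w; apply: val_inj; exact: ta_actDr. Qed.

Lemma am_scaleDl v : {morph am_scale^~ v : r s / r + s}.
Proof. by move=> r s; apply: val_inj; exact: ta_actDl. Qed.

HB.instance Definition _ :=
  GRing.Zmodule_isLmodule.Build R action_module
    am_scaleA am_scale1 am_scaleDr am_scaleDl.

Lemma action_module_simple : simple_module action_module.
Proof.
split=> [|W [W0 Wlin]].
  have [v Sv nv] := ta_neq0 D; exists (ActionModule (mem_set Sv)).
  by apply: contraNneq nv => /(congr1 am_val)/= ->.
have [[w Ww nw]|W1] := pselect (exists2 w, w \in W & w != 0); [right|left].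
  move=> v; rewrite [RHS]inE.
  have nw' : am_val w != 0 by apply: contraNneq nw => w0; apply/eqP/val_inj.
  have [r rw] := ta_trans (set_mem (am_in w)) (set_mem (am_in v)) nw'.
  have <- : r *: w + 0 = v by rewrite addr0; apply: val_inj.
  exact: Wlin.
move=> v; apply/idP/eqP => [Wv|-> //].
by apply/eqP; apply/negPn/negP => nv; apply: W1; exists v.
Qed.

Lemma left_primitive_action (P : set R) :
  (forall r, P r <-> forall v, ta_set D v -> ta_act D r v = 0) ->
  left_primitive P.
Proof.
move=> PE; exists action_module; split; first exact: action_module_simple.
apply/seteqP; split=> r.
  by move=> /PE rv v; apply: val_inj; apply: rv; exact: set_mem (am_in v).
move=> rv; apply/PE => v Sv.
by have /(congr1 am_val) := rv (ActionModule (mem_set Sv)).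
Qed.

End ActionModule.

(** * Simple modules over a ring spanned by pieces indexed by a poset *)

Section GradedRing.
Variables (R : pzRingType) (d : Order.disp_t) (I : porderType d).
(** The [h i] stand for the H(I, i). The hypotheses on them are unchanged when the multiplication is
    reversed, so the section serves B(I) and its converse ring, that is, left and right modules. *)
Variable h : I -> set R.

Definition graded_sum (J : set I) : set R := [set r | exists2 s : seq R,
  (forall x, x \in s -> exists2 j, J j & h j x) & r = \sum_(x <- s) x].

Hypothesis h_span : forall r, graded_sum setT r.
Hypothesis h_le : forall i j x y, (i <= j)%O -> h i x -> h j y ->
  h i (x * y) /\ h i (y * x).
Hypothesis h_incomparable : forall i j x y, h i x -> h j y -> x * y != 0 ->
  (i <= j)%O \/ (j <= i)%O.

(** A nonzero product lies in the piece of the smaller index. Hence the pieces below [k] span an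
    ideal. *)
Lemma h_mul_below k i j x y : (j <= k)%O -> h i x -> h j y ->
  (x * y = 0 \/ exists2 l, (l <= k)%O & h l (x * y)) /\
  (y * x = 0 \/ exists2 l, (l <= k)%O & h l (y * x)).
Proof.
move=> jk hx hy; have mul_in z : (i <= j)%O \/ (j <= i)%O ->
    z = x * y \/ z = y * x -> exists2 l, (l <= k)%O & h l z.
  case=> [ij|ji] [->|->].
  - by exists i; [exact: le_trans jk|have [] := h_le ij hx hy].
  - by exists i; [exact: le_trans jk|have [] := h_le ij hx hy].
  - by exists j => //; have [] := h_le ji hy hx.
  - by exists j => //; have [] := h_le ji hy hx.
split.
  have [->|nz] := eqVneq (x * y) 0; first by left.
  by right; apply: mul_in; [exact: h_incomparable hx hy nz|left].
have [->|nz] := eqVneq (y * x) 0; first by left.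
right; apply: mul_in; last by right.
by have [] := h_incomparable hy hx nz; [right|left].
Qed.

Variables (V : lmodType R).
Hypothesis V_simple : simple_module V.

Lemma simple_sub (W : set V) : W 0 -> (forall u v, W u -> W v -> W (u + v)) ->
  (forall r u, W u -> W (r *: u)) -> (exists2 w, W w & w != 0) ->
  forall v, W v.
Proof.
move=> W0 WD WZ [w Ww nw] v.
have [|Wz|WT] := V_simple.2 [pred u : V | `[< W u >]].
- split=> [|r u u']; rewrite !inE //.
  by move=> Wu Wu'; apply: WD => //; exact: WZ.
- have /idP : w \in [pred u : V | `[< W u >]] by rewrite inE.
  by rewrite Wz inE (negbTE nw).
- by have /idP := WT v; rewrite !inE.
Qed.

Let T (v : V) : set I := [set t | exists2 x, h t x & x *: v != 0].

(** The vectors killed by all pieces below [k] form a submodule. If it contained [v], it would be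
    all of [V], and [h k] would annihilate [V]. *)
Lemma acting_below v k : v != 0 -> (exists2 x, h k x & ~ annihilator V x) ->
  exists2 t, (t <= k)%O & T v t.
Proof.
move=> nv [x hx nx]; apply: contrapT => nT; apply: nx => w; move: w.
pose W : set V := [set u | forall j y, (j <= k)%O -> h j y -> y *: u = 0].
suff WT w : W w by move=> w; exact: WT hx.
move: w; apply: simple_sub.
- by move=> j y _ _; rewrite scaler0.
- by move=> u u' Wu Wu' j y jk hy; rewrite scalerDr (Wu _ _ jk) // (Wu' _ _ jk) // addr0.
- move=> r u Wu j y jk hy; rewrite scalerA.
  have [s hs ->] := h_span r; rewrite mulr_sumr scaler_suml big_seq big1 // => z.
  move=> /hs[i _ hz]; have [_ [->|[l lk hl]]] := h_mul_below jk hz hy.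
    by rewrite scale0r.
  exact: Wu hl.
- exists v => // j y jk hy; apply/eqP/negPn/negP => nz; apply: nT.
  by exists j => //; exists y.
Qed.

(** The images of [v] under the pieces below [t] span a submodule. It is nonzero because [t] acts on
    [v], so it contains [v] itself. *)
Lemma acting_local_unit v t : T v t -> exists2 s : seq R,
  v = \sum_(x <- s) x *: v & forall x, x \in s -> exists2 i, (i <= t)%O & h i x.
Proof.
move=> [x0 hx0 nx0].
pose W : set V := [set u | exists2 s : seq R, u = \sum_(x <- s) x *: v &
  forall x, x \in s -> exists2 i, (i <= t)%O & h i x].
suff WT u : W u by exact: WT.
move: u; apply: simple_sub.
- by exists [::]; rewrite ?big_nil.
- move=> _ _ [s -> hs] [s' -> hs']; exists (s ++ s'); first by rewrite big_cat.
  by move=> x; rewrite mem_cat => /orP[/hs|/hs'].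
- move=> r _ [s -> hs]; have [s' hs' ->] := h_span r.
  (* Zero products are dropped, since [h_mul_below] assigns them no index. *)
  exists [seq z <- [seq y * x | y <- s', x <- s] | z != 0].
    rewrite big_filter [RHS]big_mkcond big_allpairs_dep /= scaler_suml.
    apply: eq_bigr => y _; rewrite scaler_sumr; apply: eq_bigr => x _.
    by rewrite scalerA; case: eqP => //= ->; rewrite scale0r.
  move=> z; rewrite mem_filter => /andP[nz /allpairsP[[y x] /= [ys' xs ez]]].
  move: nz; rewrite {z}ez => nz.
  have [j _ hy] := hs' _ ys'; have [i it hx] := hs _ xs.
  have [[yx0|//] _] := h_mul_below it hy hx.
  by rewrite yx0 eqxx in nz.
- exists (x0 *: v) => //; exists [:: x0]; rewrite ?big_seq1 // => x.
  by rewrite inE => /eqP->; exists t.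
Qed.

(* Write [v] as a sum of [x v] with [x] in finitely many pieces [h i], [i <= t].
   Every [u] acting on [v] is comparable to one of these [i]. If no element of
   a maximal chain [C] of acting indices were below [t], then each would be
   above one of the [i], hence all of them above a single [i], which would then
   belong to [C]. *)
Lemma acting_chain : exists A : set I, [/\ A !=set0, is_chain A,
  (forall a, A a -> exists2 x, h a x & ~ annihilator V x) &
  forall k, (exists2 x, h k x & ~ annihilator V x) ->
    exists2 a, A a & (a <= k)%O].
Proof.
have [[v nv] _] := V_simple.
have [C [cC _ CT maxC]] := @chain_maximal_in _ I (T v) set0
  (fun x y (x0 : set0 x) => False_ind _ x0) (@sub0set _ _).
have T0 : exists t, T v t.
  apply: contrapT => nT; move/eqP: nv; apply.
  have [s hs e1] := h_span 1.
  rewrite -[v]scale1r e1 scaler_suml big_seq big1 // => x /hs[t _ hx].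
  by apply/eqP/negPn/negP => nz; apply: nT; exists t, x.
have add_C t : T v t -> (forall c, C c -> (t <= c)%O \/ (c <= t)%O) -> C t.
  move=> Tt tC; apply: (maxC (C `|` [set t])) => [x y|x|x|]; last by right.
  - move=> [Cx|->] [Cy|->]; [exact: cC| |exact: tC|by left].
    by have [] := tC _ Cx; [right|left].
  - by left.
  - by case=> [/CT|->].
have C0 : C !=set0.
  have [t Tt] := T0; apply: contrapT => nC; apply: (nC); exists t.
  by apply: add_C => // c Cc; case: nC; exists c.
exists C; split=> // [a /CT[x hx nx]|k].
  by exists x => // /(_ v) x0; rewrite x0 eqxx in nx.
move=> /(acting_below nv)[t tk Tt]; apply: contrapT => nCk.
have [s vE hs] := acting_local_unit Tt.
(* [L] collects indices of the terms [x] of [s] with [x *: v] nonzero. If [y *: v] is nonzero, so is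
   some [(y * x) *: v], which makes the index of [y] comparable to that of [x]. *)
have [L LT LC] : exists2 L : seq I, (forall i, i \in L -> T v i /\ (i <= t)%O) &
    forall u, T v u -> exists2 i, i \in L & (i <= u)%O \/ (u <= i)%O.
  have {vE} : forall u y, h u y -> y *: v != 0 ->
      exists2 x, x \in s & (y * x) *: v != 0.
    move=> u y hy; rewrite {1}vE scaler_sumr; apply: contra_neqP => nx.
    rewrite big_seq big1 // => x xs; rewrite scalerA.
    by apply/eqP/negPn/negP => nz; apply: nx; exists x.
  suff [L LT Ls] : exists2 L : seq I, (forall i, i \in L -> T v i /\ (i <= t)%O) &
      forall x, x \in s -> x *: v != 0 -> exists2 i, i \in L & h i x.
    move=> vE; exists L => // u [y hy nyv]; have [x xs nyxv] := vE u y hy nyv.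
    have [|i iL hx] := Ls x xs.
      by apply: contraNneq nyxv => xv0; rewrite -scalerA xv0 scaler0.
    exists i => //.
    have [] := h_incomparable hy hx; [|by right|by left].
    by apply: contraNneq nyxv => ->; rewrite scale0r.
  elim: s hs => [|x s IHs] hs; first by exists [::].
  have [|L LT Ls] := IHs; first by move=> y ys; apply: hs; rewrite inE ys orbT.
  have [i it hx] := hs x (mem_head _ _).
  have [xv0|nxv] := eqVneq (x *: v) 0.
    exists L => // y; rewrite inE => /orP[/eqP->|/Ls //].
    by rewrite xv0 eqxx.
  exists (i :: L) => [j|y].
    by rewrite inE => /orP[/eqP->|/LT //]; split=> //; exists x.
  rewrite inE => /orP[/eqP-> _|ys /(Ls _ ys)[j jL hy]].
    by exists i => //; rewrite mem_head.
  by exists j => //; rewrite inE jL orbT.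
have nCt c : C c -> ~ (c <= t)%O.
  by move=> Cc ct; apply: nCk; exists c => //; exact: le_trans tk.
(* Otherwise a small enough [c] in [C] is above no member of [L]; by comparability it is below one,
   hence below [t]. *)
have [f [fL fC]] : exists f, f \in L /\ forall c, C c -> (f <= c)%O.
  apply: contrapT => nf.
  have [||c Cc cL] := @chain_lower_bound _ I C _ L (fun f c => ~ (f <= c)%O) cC C0.
  - by move=> f x y yx nfx fy; apply: nfx; exact: le_trans yx.
  - move=> f fL; apply: contrapT => nc; apply: nf; exists f; split=> // c Cc.
    by apply: contrapT => nfc; apply: nc; exists c.
  have [i iL [/(cL _ iL) //|ci]] := LC _ (CT _ Cc).
  by apply: (nCt _ Cc); apply: le_trans ci _; have [] := LT _ iL.
have [Tf ft] := LT _ fL; apply: (nCt f) => //.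
by apply: add_C => // c Cc; left; exact: fC.
Qed.

End GradedRing.

(** * Finite sums and matrix units *)

Section FsetSums.
Variables (T : choiceType) (V : zmodType).
Implicit Types (F G : {fset T}) (f : T -> V).

Lemma sum_fsetD1 F f t : t \in F ->
  \sum_(i <- F) f i = f t + \sum_(i <- (F `\ t)%fset) f i.
Proof. exact: big_fsetD1. Qed.

Lemma sum_fset_widen F G f : (F `<=` G)%fset -> (forall t, t \notin F -> f t = 0) ->
  \sum_(i <- F) f i = \sum_(i <- G) f i.
Proof. by move=> FG f0; apply: big_fset_incl => // t _; exact: f0. Qed.

End FsetSums.

Section MatrixUnits.
Variables (K : fieldType) (X : choiceType).
Implicit Types (a b : cfm K X) (u v x y : X).

Lemma cfm_unit_finite u v y :
  finite_set [set x | ((x == u) && (y == v))%:R != 0 :> K].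
Proof.
apply: (sub_finite_set _ (finite_set1 u)) => x /=.
by case: (eqVneq x u) => //= _; rewrite eqxx.
Qed.
Definition cfm_unit u v := CFM (cfm_unit_finite u v).

Lemma cfm_unitE u v x y : cfm_unit u v x y = ((x == u) && (y == v))%:R.
Proof. by []. Qed.

Lemma cfm_unit_mulE u v a x y : (cfm_unit u v * a) x y = (x == u)%:R * a v y.
Proof.
rewrite cfmME (fsbigTE [fset v]%fset) => [|z].
  by rewrite big_seq_fset1 cfm_unitE eqxx andbT.
by rewrite inE cfm_unitE => /negbTE->; rewrite andbF mul0r.
Qed.

Lemma cfm_mul_unitE u v a x y : (a * cfm_unit u v) x y = a x u * (y == v)%:R.
Proof.
rewrite cfmME (fsbigTE [fset u]%fset) => [|z].
  by rewrite big_seq_fset1 cfm_unitE eqxx.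
by rewrite inE cfm_unitE => /negbTE->; rewrite mulr0.
Qed.

Lemma FR_cfm_unit u v : FR (cfm_unit u v).
Proof.
apply: (sub_finite_set _ (finite_set1 u)) => x /= [y].
by case: (eqVneq x u) => //= _; rewrite eqxx.
Qed.

Lemma cfm_unit_sandwich x u a v y :
  cfm_unit x u * a * cfm_unit v y = a u v *: cfm_unit x y.
Proof.
apply: cfmP => z t.
rewrite cfm_mul_unitE cfm_unit_mulE cfmZE cfm_unitE mulrAC mulrC -natrM.
by rewrite mulnb.
Qed.

(** The right side is row [x] of [b]. So one nonzero entry of [a] suffices for the two-sided
    multiples of [a] to reach every row of every matrix, which with [FR_rows] is the simplicity of
    [FR]. *)
Lemma cfm_unit_divide a b u v x : a u v != 0 ->
  cfm_unit x u * a * ((a u v)^-1 *: (cfm_unit v x * b)) = cfm_unit x x * b.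
Proof.
move=> nz; rewrite -cfmZAr mulrA (cfm_unit_sandwich x u a v x) -cfmZAl.
by apply: cfmP => z t; rewrite !cfmZE mulrA mulVf // mul1r.
Qed.

Lemma FR_rows b : FR b -> exists s : seq X, b = \sum_(x <- s) cfm_unit x x * b.
Proof.
move=> /finite_fsetP[A bA]; exists A; apply: cfmP => x y; rewrite cfm_sumE.
have [xA|xA] := boolP (x \in A).
  rewrite (sum_fsetD1 _ xA) cfm_unit_mulE eqxx mul1r big_seq big1 ?addr0 // => z.
  rewrite !inE cfm_unit_mulE eq_sym => /andP[/negbTE-> _].
  by rewrite mul0r.
rewrite big_seq big1 => [|z zA].
  apply/eqP; apply: contraNT xA => nb.
  have : [set` A] x by rewrite -bA; exists y.
  by [].
rewrite cfm_unit_mulE; case: (eqVneq x z) => [xz|]; last by rewrite mul0r.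
by rewrite xz zA in xA.
Qed.

Lemma FRD a b : FR a -> FR b -> FR (a + b).
Proof.
move=> Fa Fb; have : finite_set ([set x | exists y, a x y != 0] `|`
    [set x | exists y, b x y != 0]) by rewrite finite_setU.
apply: sub_finite_set => x /= [y].
have [->|ax _] := eqVneq (a x y) 0; last by left; exists y.
by rewrite add0r; right; exists y.
Qed.

Lemma FRZ (c : K) a : FR a -> FR (c *: a).
Proof.
by apply: sub_finite_set => x /= [y]; rewrite mulf_eq0 negb_or => /andP[_ ?]; exists y.
Qed.

End MatrixUnits.

(** * The pieces H(I, i): blocks, directness of the sum, and ideals *)

Section Hpieces.
Variables (d' : Order.disp_t) (aleph : bOrderType d') (K : fieldType).
Variables (d : Order.disp_t) (I : porderType d).
Local Notation Q := (Qalg aleph K I).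
Implicit Types (i j k c : I) (m : Q) (J : set I).

Lemma psiD i (a b : cfm K (idx aleph (up i))) : psi (a + b) = psi a + psi b.
Proof.
apply: cfmP => x y; have [l|nl] := pselect (linked i x y).
  by rewrite cfmDE !(psiE _ (linked_l l) (linked_r l) l).
by rewrite cfmDE !psi_eq0 // addr0.
Qed.

Lemma psi_sum i (T : Type) (s : seq T) (F : T -> cfm K (idx aleph (up i))) :
  psi (\sum_(t <- s) F t) = \sum_(t <- s) psi (F t) :> Q.
Proof. exact: (big_morph _ (@psiD i) (@psi0 _ aleph K _ I i)). Qed.

Lemma HelD i m m' : Hel i m -> Hel i m' -> Hel i (m + m').
Proof.
rewrite /Hel; case: ifP => _ [a Fa <-] [b Fb <-].
  by exists (a + b); rewrite ?scalerDl.
by exists (a + b); rewrite ?psiD //; exact: FRD.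
Qed.

Lemma Hel_nonmax i m : ~ maximal_element i ->
  Hel i m <-> exists2 a, FR a & psi (i := i) a = m.
Proof. by move=> ni; rewrite /Hel asboolF. Qed.

Lemma Hel_max i m : maximal_element i ->
  Hel i m <-> exists c : K, m = c *: psi (i := i) 1.
Proof. by move=> mi; rewrite /Hel asboolT //; split=> [[c _ <-]|[c ->]]; exists c. Qed.

Lemma HelZ i (l : K) m : Hel i m -> Hel i (l *: m).
Proof.
have [mi|ni] := pselect (maximal_element i).
  by move=> /(Hel_max _ mi)[c ->]; apply/(Hel_max _ mi); exists (l * c); rewrite scalerA.
move=> /(Hel_nonmax _ ni)[a Fa <-]; apply/(Hel_nonmax _ ni).
by exists (l *: a); [exact: FRZ|rewrite psiZ].
Qed.

Lemma Hsum_sub J J' m : J `<=` J' -> Hsum J m -> Hsum J' m.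
Proof.
move=> JJ' [s sJ ->]; exists s => // x /sJ[j Jj hj]; exists j => //.
exact: JJ'.
Qed.

(* The classes of [block i] index the blocks on which [Hel i] acts: for [i]
   maximal, [Hel i] consists of diagonal matrices. *)
Definition block i (x y : idx aleph I) : Prop :=
  linked i x y /\ (maximal_element i -> x = y).

Lemma block_l i x y : block i x y -> mc_set x.2 i.
Proof. by case=> /linked_l. Qed.

Lemma block_r i x y : block i x y -> mc_set y.2 i.
Proof. by case=> /linked_r. Qed.

Lemma block_refl i x : mc_set x.2 i -> block i x x.
Proof. by move=> xi; split; [exact: linked_refl|]. Qed.

Lemma block_sym i x y : block i x y -> block i y x.
Proof. by case=> [/linked_sym l e]; split=> // /e. Qed.

Lemma block_trans i x y z : block i x y -> block i y z -> block i x z.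
Proof.
case=> [lxy exy] [lyz eyz]; split; first exact: linked_trans lyz.
by move=> mi; rewrite exy ?eyz.
Qed.

Lemma block_weaken i j x y : (i <= j)%O -> block j x y -> mc_set x.2 i ->
  block i x y.
Proof.
move=> ij [l e] xi; split; first exact: linked_weaken l xi.
by move=> maxi; apply: e; rewrite (maxi _ ij).
Qed.

Lemma Hel_block i m x y : Hel i m -> m x y != 0 -> block i x y.
Proof.
move=> Hm nz; split; first exact: Hel_neq0 Hm nz.
move=> maxi; move: nz; have /(Hel_max _ maxi)[c ->] := Hm.
rewrite cfmZE psi1E; case: (eqVneq x y) => //=.
by rewrite mulr0 eqxx.
Qed.

(** Terms of equal index are merged. The family [f] is total and vanishes off [F], so that two such
    expressions can be compared over the union of their index sets. *)
Lemma Hsum_normal J m : Hsum J m -> exists (F : {fset I}) (f : I -> Q),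
  [/\ forall j, Hel j (f j), forall j, j \in F -> J j,
      forall j, j \notin F -> f j = 0 & m = \sum_(j <- F) f j].
Proof.
case=> s; elim: s m => [|h s IHs] m hs ->.
  exists fset0, (fun=> 0); split=> // [j|].
    exact: Hel0.
  by rewrite big_nil big_seq_fset0.
have [|F [f [Hf FJ f0 fE]]] := IHs _ _ erefl.
  by move=> x xs; apply: hs; rewrite inE xs orbT.
have [j Jj Hh] := hs h (mem_head _ _).
exists (j |` F)%fset, (fun k => if k == j then h + f k else f k); split=> [k|k|k|].
- by case: eqP => // ->; exact: HelD.
- by rewrite !inE => /orP[/eqP->|/FJ].
- by rewrite !inE negb_or => /andP[/negbTE-> /f0].
- have jF : j \in (j |` F)%fset by exact: fset1U1.
  rewrite big_cons fE (sum_fset_widen (G := (j |` F)%fset)) ?fsubsetUr //.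
  rewrite (sum_fsetD1 _ jF) [RHS](sum_fsetD1 _ jF) eqxx addrA; congr (_ + _).
  by apply: eq_big_seq => k; rewrite !inE => /andP[/negbTE->].
Qed.

Lemma cfm_neq0 (X : choiceType) (a : cfm K X) : a != 0 -> exists x y, a x y != 0.
Proof.
apply: contra_neqP => na; apply: cfmP => x y; apply/eqP/negPn/negP => nz.
by apply: na; exists x, y.
Qed.

(** [psi] repeats one matrix on every class of linked indices, so a nonzero entry reappears in the
    class of [w]. For [k] maximal, the diagonal of [m] is constant on the indices through [k]. *)
Lemma Hel_translate k m w : Hel k m -> m != 0 -> mc_set w.2 k ->
  exists x y, [/\ block k w x, block k w y & m x y != 0].
Proof.
move=> Hm /cfm_neq0[x [y nz]] wk; have [mk|nk] := pselect (maximal_element k).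
  exists w, w; split; [exact: block_refl|exact: block_refl|].
  move: nz; have /(Hel_max _ mk)[c ->] := Hm.
  rewrite [X in _ -> X != 0]cfmZE psi1E eqxx asboolT // mulr1.
  by apply: contraNneq => ->; rewrite scale0r.
have [a ma] := Hel_psi Hm.
have l : linked k x y by have [] := Hel_block Hm nz.
move: nz; rewrite ma (psiE _ (linked_l l) (linked_r l)) // => nz.
have bw u : block k w (idx_glue wk u) by split=> //; exact: glue_linked.
exists (idx_glue wk (idx_restrict (linked_l l))),
  (idx_glue wk (idx_restrict (linked_r l))); split=> //.
rewrite (psiE _ (glue_i wk _) (glue_i wk _)) ?glueK //.
by have [lk _] := block_trans (block_sym (bw (idx_restrict (linked_l l))))
  (bw (idx_restrict (linked_r l))).
Qed.

(** Every nonzero row of [psi a] restricts to one of the finitely many nonzero rows of [a], and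
    restriction keeps the coordinate [j]. *)
Lemma Hel_row_values j m : ~ maximal_element j -> Hel j m ->
  exists2 S : set aleph, finite_set S & forall x y, m x y != 0 -> S (x.1 j).
Proof.
move=> nj /(Hel_nonmax _ nj)[a Fa <-].
exists [set u.1 (Up (lexx j)) | u in [set u | exists v, a u v != 0]].
  exact: finite_image.
move=> x y nz; have l := psi_neq0 nz.
exists (idx_restrict (linked_l l)) => //.
by exists (idx_restrict (linked_r l)); rewrite -psiE.
Qed.

(* At an index [x] through [k] whose values [x.1 j], [j < k], avoid the finitely
   many ones that occur in the nonzero rows of [f j], only the terms [f j] with
   [k <= j] contribute to the row [x] of the sum. *)
Lemma Hel_sum_neq0 (F : {fset I}) (f : I -> Q) : infinite_set [set: aleph] ->
  (forall j, Hel j (f j)) -> (exists2 k, k \in F & f k != 0) ->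
  exists k, [/\ k \in F, f k != 0 & forall w : idx aleph I, mc_set w.2 k ->
    exists w' : idx aleph I, [/\ w'.2 = w.2,
      forall j, j \notin F -> w'.1 j = w.1 j &
      exists x y, [/\ block k w' x, block k w' y &
        (\sum_(j <- F) f j) x y != 0]]].
Proof.
move=> infA Hf [k0 k0F nk0].
(* By maximality, [f k] is the only nonzero term whose index is above [k]. *)
have [|k] := @seq_maximal _ _ [seq j <- F | f j != 0] k0.
  by rewrite mem_filter nk0.
rewrite mem_filter => /andP[nfk kF] maxk; exists k; split=> // w wk.
have /choice[g gE] : forall j, exists n : aleph, ~ maximal_element j ->
    forall x y, f j x y != 0 -> x.1 j <> n.
  move=> j; have [mj|nj] := pselect (maximal_element j); first by exists \bot%O.
  have [S fS Sf] := Hel_row_values nj (Hf j).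
  have [n [_ nS]] := infinite_setN0 (infinite_setD infA fS).
  by exists n => _ x y /Sf Sx xn; apply: nS; rewrite -xn.
have pfin : finite_set [set j | (if j \in F then g j else w.1 j) != \bot%O].
  have : finite_set ([set` F] `|` [set j | w.1 j != \bot%O]).
    by rewrite finite_setU; split; [exact: finite_fset|exact: fsupp_finite].
  by apply: sub_finite_set => j /=; case: ifP => [jF _|_ nj]; [left|right].
exists (FSupp pfin, w.2); split=> //= [j /negbTE-> //|].
have [x [y [wx wy nz]]] := Hel_translate (w := (FSupp pfin, w.2)) (Hf k) nfk wk.
exists x, y; split=> //; rewrite cfm_sumE (sum_fsetD1 _ kF) big_seq big1 ?addr0 // => j.
rewrite !inE => /andP[njk jF]; apply/eqP/negPn/negP => nfj.
have nfj0 : f j != 0 by apply: contraNneq nfj => ->.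
have nkj : ~~ (k <= j)%O.
  apply: contra njk => kj; apply/eqP; apply: maxk => //.
  by rewrite mem_filter nfj0.
have jk : (j <= k)%O.
  have [//|kj] := mc_chain (block_l (Hel_block (Hf j) nfj)) (block_r wx).
  by rewrite kj in nkj.
have nj : ~ maximal_element j.
  by move=> mj; rewrite (mj _ jk) lexx in nkj.
(* Indices linked at [k] agree at the coordinates not above [k], so [x] still has the avoided value
   [g j] at [j]. *)
apply: (gE j nj _ _ nfj); have [[_ _ <-] // _] := wx.
by rewrite /= jF.
Qed.

Lemma idx_of_chain (A : set I) : is_chain A ->
  exists w : idx aleph I, A `<=` mc_set w.2.
Proof.
move=> /max_chain_exists[C AC].
have f0 : finite_set [set j : I | (\bot%O : aleph) != \bot%O].
  by apply: (sub_finite_set _ (finite_set0 I)) => j /=; rewrite eqxx.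
by exists (FSupp f0, C).
Qed.

Lemma max_chain_through c : exists w : idx aleph I, mc_set w.2 c.
Proof. by have [w cw] := idx_of_chain (@is_chain1 _ _ c); exists w; exact: cw. Qed.

(** This is the directness of the sum. Two expressions of a nonzero [m], over [J] and off [J], would
    differ by a family with a nonzero term and zero sum, against [Hel_sum_neq0]. *)
Lemma Hsum_disjoint J m : infinite_set [set: aleph] ->
  Hsum J m -> Hsum (~` J) m -> m = 0.
Proof.
move=> infA /Hsum_normal[F [f [Hf FJ f0 mf]]] /Hsum_normal[G [g [Hg GJ g0 mg]]].
apply/eqP/negPn/negP => nm.
have [k kF nk] : exists2 k, k \in F & f k != 0.
  apply: contrapT => nk; move/eqP: nm; apply; rewrite mf big_seq big1 // => j jF.
  by apply/eqP/negPn/negP => nfj; apply: nk; exists j.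
have fgE : \sum_(j <- (F `|` G)%fset) (f j - g j) = 0.
  rewrite sumrB -(sum_fset_widen (f := f) (F := F)) ?fsubsetUl //.
  rewrite -(sum_fset_widen (f := g) (F := G)) ?fsubsetUr //.
  by apply/eqP; rewrite subr_eq0; apply/eqP; exact: etrans (esym mf) mg.
have [||k' [_ _ wk']] := @Hel_sum_neq0 (F `|` G)%fset (fun j => f j - g j) infA.
- by move=> j; apply: HelD => //; exact: HelN.
- exists k; first by rewrite !inE kF.
  rewrite g0 ?subr0 //; apply/negP => /GJ; apply; exact: FJ.
have [w /wk'[w' [_ _ [x [y [_ _]]]]]] := max_chain_through k'.
by rewrite fgE eqxx.
Qed.

Lemma Hsum_max c m : maximal_element c -> Hsum [set j | (c <= j)%O] m -> Hel c m.
Proof.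
move=> mc [s hs ->]; rewrite big_seq; apply: big_ind => [||h /hs[j cj]].
- exact: Hel0.
- exact: HelD.
- by rewrite (mc j cj).
Qed.

(** [Hel_sum_neq0] detects [m] near an index through some [k >= c]. Such an index exists in the
    block of [w], and the coordinates that must be changed are all above [c], so the block at [c]
    stays the same. *)
Lemma Hsum_up_support c m w : infinite_set [set: aleph] ->
  Hsum [set j | (c <= j)%O] m -> m != 0 -> mc_set w.2 c ->
  exists x y, [/\ block c w x, block c w y & m x y != 0].
Proof.
move=> infA Hm nm wc; have [mc|nc] := pselect (maximal_element c).
  exact: Hel_translate (Hsum_max mc Hm) nm wc.
have /Hsum_normal[F [f [Hf Fc f0 mf]]] := Hm.
have [|k [kF _ kP]] := Hel_sum_neq0 (F := F) infA Hf.
  apply: contrapT => nk; move/eqP: nm; apply; rewrite mf big_seq big1 // => j jF.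
  by apply/eqP/negPn/negP => nfj; apply: nk; exists j.
have ck : (c <= k)%O := Fc k kF.
have [C Ck] := max_chain_exists (@is_chain1 _ _ (Up ck)).
(* [w1] has the coordinates of [w] and its chain up to [c], continued by a chain through [k]. *)
pose w1 := idx_glue wc ((idx_restrict wc).1, C).
have [|w' [w'2 w'1 [x [y [w'x w'y nz]]]]] := kP w1.
  by apply/(glue_up _ _ ck); exact: Ck.
have ww' : block c w w'.
  split=> //; have [[_ w1c] ww1 w1E] := glue_linked wc ((idx_restrict wc).1, C).
  split=> [||j ncj]; rewrite ?w'2 //.
  rewrite w'1 ?w1E //; apply/negP => /Fc cj.
  by rewrite cj in ncj.
exists x, y; rewrite mf; split=> //.
  by apply: block_trans ww' (block_weaken ck w'x (block_r ww')).
by apply: block_trans ww' (block_weaken ck w'y (block_r ww')).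
Qed.

Lemma Hsum_up_local c m : Hsum [set j | (c <= j)%O] m -> local_at c m.
Proof.
move=> [s hs ->]; rewrite big_seq; apply: big_ind => [|a b [la ea] [lb eb]|h].
- by split=> // x y; rewrite cfm0E eqxx.
- split=> [x y|w w' wc wc' u v]; last by rewrite !cfmDE (ea _ _ wc wc') (eb _ _ wc wc').
  rewrite cfmDE; have [->|nz _] := eqVneq (a x y) 0; last exact: la.
  by rewrite add0r; exact: lb.
- by move=> /hs[j cj /Hel_psi[a ->]]; exact: local_psi.
Qed.

(** A matrix local at [c] may have entries at indices whose chains avoid [c]. The factor [psi a]
    removes them, and one class determines the rest. *)
Lemma psi_mul_local c w (wc : mc_set w.2 c) a m : local_at c m ->
  psi a * m = psi (a * compress m wc).
Proof.
move=> lm; have la : local_at c (psi a) by exact: local_psi.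
rewrite -[in RHS](compress_psi a wc) -compressM // psi_compress //.
  exact: local_atM.
by move=> x y /cfm_mul_neq0[z /psi_neq0/linked_l].
Qed.

Lemma psiM c (a b : cfm K (idx aleph (up c))) : psi (a * b) = psi a * psi b.
Proof.
have [w wc] := max_chain_through c.
by rewrite (psi_mul_local wc) ?compress_psi //; exact: local_psi.
Qed.

(* [Hel c] is a field or a simple ring, and [m] does not act as zero on it. *)
Lemma Hel_sub_ideal c m (P : set Q) : infinite_set [set: aleph] ->
  Hsum [set j | (c <= j)%O] m -> m != 0 -> P 0 ->
  (forall p q, P p -> P q -> P (p + q)) ->
  (forall h h', Hel c h -> Hel c h' -> P (h * m * h')) -> Hel c `<=` P.
Proof.
move=> infA Hm nm P0 PD PM h; have [mc|nc] := pselect (maximal_element c).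
  have /(Hel_max _ mc)[l ml] := Hsum_max mc Hm.
  have nl : l != 0 by apply: contraNneq nm => l0; rewrite ml l0 scale0r.
  move=> /(Hel_max _ mc)[k ->].
  have -> : k *: psi (i := c) 1 = (k / l) *: psi (i := c) 1 * m * psi (i := c) 1 :> Q.
    rewrite ml -!psiZ -!psiM; congr psi.
    by rewrite -cfmZAl mul1r scalerA divfK // mulr1.
  by apply: PM; apply/(Hel_max _ mc); [exists (k / l)|exists 1; rewrite scale1r].
have [w wc] := max_chain_through c.
have lm := Hsum_up_local Hm.
have [u [v nz]] : exists u v, compress m wc u v != 0.
  have [x [y [[wx _] [wy _] nz]]] := Hsum_up_support infA Hm nm wc.
  exists (idx_restrict (linked_r wx)), (idx_restrict (linked_r wy)).
  by rewrite /= !restrictK.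
move=> /(Hel_nonmax _ nc)[b Fb <-].
have [s ->] := FR_rows Fb; rewrite psi_sum; apply: big_ind => // x _.
have -> : psi (cfm_unit K x x * b) = psi (cfm_unit K x u) * m *
    psi ((compress m wc u v)^-1 *: (cfm_unit K v x * b)).
  by rewrite (psi_mul_local wc) // -psiM cfm_unit_divide.
apply: PM; apply/(Hel_nonmax _ nc); eexists; try reflexivity.
  exact: FR_cfm_unit.
by apply: FRZ; exact/FRM/FR_cfm_unit.
Qed.

(** Copying [t] from the block of [w] to all classes gives an element of H(I, a) that acts like [t]
    on rows and columns supported on that block. For [a] maximal the block is [w] alone and [t] is a
    scalar there. *)
Lemma Hel_block_lift a w (t : Q) : mc_set w.2 a -> FR t ->
  (forall x y, t x y != 0 -> block a w x /\ block a w y) ->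
  exists2 r, Hel a r &
    forall x y, block a w x \/ block a w y -> r x y = t x y.
Proof.
move=> wa Ft tw; have [ma|na] := pselect (maximal_element a).
  exists (t w w *: psi (i := a) 1); first by apply/(Hel_max _ ma); exists (t w w).
  have t0 x y : x <> w \/ y <> w -> t x y = 0.
    move=> xyw; apply/eqP/negPn/negP => /tw[[_ /(_ ma) wx] [_ /(_ ma) wy]].
    by case: xyw; apply.
  move=> x y; rewrite cfmZE psi1E => -[] [_ /(_ ma) <-].
    have [<-|/eqP nwy] := eqVneq w y; first by rewrite asboolT // mulr1.
    by rewrite mulr0 t0 //; right => yw; apply: nwy.
  have [->|/eqP nxw] := eqVneq x w; first by rewrite asboolT // mulr1.
  by rewrite mulr0 t0 //; left.
exists (psi (compress t wa)).
  apply/(Hel_nonmax _ na); exists (compress t wa) => //.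
  have : finite_set (idx_glue wa @^-1` [set x | exists y, t x y != 0]).
    by apply: (finite_preimage _ Ft) => x y _ _; exact: glue_inj.
  by apply: sub_finite_set => u /= [v]; exists (idx_glue wa v).
move=> x y wxy; have [l|nl] := pselect (linked a x y).
  have [lx ly] : linked a w x /\ linked a w y.
    case: wxy => -[lw _]; split=> //; first exact: linked_trans l.
    exact: linked_trans (linked_sym l).
  by rewrite (psiE _ (linked_l l) (linked_r l)) //= !restrictK.
rewrite psi_eq0 //; apply/esym/eqP/negPn/negP => /tw[[wx _] [wy _]].
exact/nl/(linked_trans (linked_sym wx)).
Qed.

End Hpieces.

(** * Decompositions and ideals of B(I) *)

Section Primitive.
Variables (d' : Order.disp_t) (aleph : bOrderType d') (K : fieldType).
Variables (d : Order.disp_t) (I : porderType d) (hI : has_finite_cofinal I).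
Hypothesis aleph_infinite : infinite_set [set: aleph].
Local Notation Q := (Qalg aleph K I).
Local Notation B := (Balg aleph K hI).
Implicit Types (i j k : I) (m p q v w t : Q) (r s b : B) (J : set I).

Lemma H_in_B_sum J b : H_in_B aleph K hI J b -> exists2 s : seq B,
  (forall x, x \in s -> exists2 j, J j & Hel j (B_val x)) &
  b = \sum_(x <- s) x.
Proof.
case=> s hs; elim: s b hs => [|h s IHs] b hs bE.
  by exists [::] => //; apply: val_inj; rewrite big_nil -[LHS]/(B_val b) bE big_nil.
have [j Jj Hh] := hs h (mem_head _ _).
pose hB : B := MkB hI (mem_set (Hel_Hsum (J := setT) (j := j) Logic.I Hh)).
have [||t tJ bhE] := IHs (b - hB).
- by move=> x xs; apply: hs; rewrite inE xs orbT.
- by rewrite -[LHS]/(B_val b - h) bE big_cons addrAC subrr add0r.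
exists (hB :: t) => [x|]; last by rewrite big_cons -bhE addrC subrK.
by rewrite inE => /orP[/eqP->|/tJ //]; exists j.
Qed.

Lemma Hsum_split J m : Hsum setT m ->
  exists2 p, Hsum J p & Hsum (~` J) (m - p).
Proof.
move=> [s hs ->]; elim: s hs => [|h s IHs] hs.
  by exists 0; rewrite ?big_nil ?subr0; exact: Hsum0.
have [|p Jp Jm] := IHs; first by move=> x xs; apply: hs; rewrite inE xs orbT.
have [j _ Hh] := hs h (mem_head _ _); rewrite big_cons.
have [Jj|Jj] := pselect (J j).
  exists (h + p); first by apply: HsumD => //; exact: Hel_Hsum Jj Hh.
  by rewrite opprD addrACA subrr add0r.
exists p => //; rewrite -addrA; apply: HsumD => //; exact: Hel_Hsum Hh.
Qed.

(** Comparable pieces multiply into the lower one, which a lower set [J] retains; incomparable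
    pieces multiply to zero because no chain passes through both indices. *)
Lemma Hsum_ideal J m m' : (forall i j, (i <= j)%O -> J j -> J i) ->
  Hsum J m -> Hsum setT m' -> Hsum J (m * m') /\ Hsum J (m' * m).
Proof.
move=> lowJ [s hs ->] [s' hs' ->]; rewrite mulr_suml mulr_sumr.
suff hJ h h' : h \in s -> h' \in s' -> Hsum J (h * h') /\ Hsum J (h' * h).
  split; apply: Hsum_sum => h sh; rewrite ?mulr_suml ?mulr_sumr.
    by apply: Hsum_sum => h' sh'; have [] := hJ _ _ sh sh'.
  by apply: Hsum_sum => h' sh'; have [] := hJ _ _ sh sh'.
move=> /hs[i Ji Hh] /hs'[j _ Hh'].
have [ij|nij] := boolP (i <= j)%O.
  by have [? ?] := HelM_le ij Hh Hh'; split; exact: Hel_Hsum Ji _.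
have [ji|nji] := boolP (j <= i)%O.
  by have [? ?] := HelM_le ji Hh' Hh; split; exact: Hel_Hsum (lowJ _ _ ji Ji) _.
suff [-> ->] : h * h' = 0 /\ h' * h = 0 by split; exact: Hsum0.
split; apply: cfmP => x y; apply/eqP/negPn/negP => /cfm_mul_neq0[z].
  move=> /(Hel_neq0 Hh)/linked_r zi /(Hel_neq0 Hh')/linked_l zj.
  by have [] := mc_chain zi zj; rewrite ?(negbTE nij) ?(negbTE nji).
move=> /(Hel_neq0 Hh')/linked_r zj /(Hel_neq0 Hh)/linked_l zi.
by have [] := mc_chain zi zj; rewrite ?(negbTE nij) ?(negbTE nji).
Qed.

(** * The simple modules attached to a nonempty chain *)

Section ChainModules.
Variable A : set I.
Hypotheses (A_chain : is_chain A) (A0 : A !=set0).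
Local Notation low := (not_above A).
Local Notation high := (~` (not_above A)).

Lemma low_lower i j : (i <= j)%O -> low j -> low i.
Proof. by move=> ij nj [a Aa ai]; apply: nj; exists a => //; exact: le_trans ij. Qed.

Lemma high_above j : high j -> exists2 a, A a & (a <= j)%O.
Proof. exact: contrapT. Qed.

(** The decomposition is picked by choice, but directness of the sum makes it unique. As the
    complementary summand is an ideal, this projection is additive and multiplicative. *)
Definition upper_part b : Q :=
  projT1 (cid2 (Hsum_split high (B_valP b))).

Lemma upper_part_high b : Hsum high (upper_part b).
Proof. by rewrite /upper_part; case: cid2. Qed.

Lemma upper_part_low b : Hsum low (B_val b - upper_part b).
Proof. by rewrite /upper_part; case: cid2 => p /= _; rewrite setCK. Qed.

Lemma upper_part_uniq b p : Hsum high p -> Hsum low (B_val b - p) ->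
  upper_part b = p.
Proof.
move=> hp lp; apply/eqP; rewrite -subr_eq0; apply/eqP.
apply: (@Hsum_disjoint _ _ _ _ _ low) => //.
  have -> : upper_part b - p = (B_val b - p) - (B_val b - upper_part b).
    by rewrite opprB [RHS]addrC addrA subrK.
  by apply: HsumD => //; apply: HsumN; exact: upper_part_low.
by apply: HsumD; [exact: upper_part_high|exact: HsumN].
Qed.

Lemma upper_partD r s : upper_part (r + s) = upper_part r + upper_part s.
Proof.
apply: upper_part_uniq.
  by apply: HsumD; exact: upper_part_high.
have -> : B_val (r + s) - (upper_part r + upper_part s) =
    (B_val r - upper_part r) + (B_val s - upper_part s).
  by rewrite addrACA opprD.
by apply: HsumD; exact: upper_part_low.
Qed.

Lemma upper_partM r s : upper_part (r * s) = upper_part r * upper_part s.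
Proof.
apply: upper_part_uniq.
  by apply: HsumM; exact: upper_part_high.
have -> : B_val (r * s) - upper_part r * upper_part s =
    (B_val r - upper_part r) * B_val s + upper_part r * (B_val s - upper_part s).
  by rewrite B_valM mulrBl mulrBr addrA subrK.
have upT : Hsum setT (upper_part r) by exact: Hsum_sub (upper_part_high r).
apply: HsumD.
  by have [] := Hsum_ideal low_lower (upper_part_low r) (B_valP s).
by have [] := Hsum_ideal low_lower (upper_part_low s) upT.
Qed.

(** Each of the finitely many summands has an index above some element of [A], and the least of
    these elements is below all the indices. *)
Lemma Hsum_high_up m : Hsum high m ->
  exists2 a, A a & Hsum [set j | (a <= j)%O] m.
Proof.
move=> [s hs mE].
have [||a Aa ha] := @chain_lower_bound _ I A _ s
  (fun (h : Q) (a : I) => exists2 j, (a <= j)%O & Hel j h) A_chain A0.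
- by move=> h x y yx [j xj Hj]; exists j => //; exact: le_trans xj.
- by move=> h /hs[j /high_above[a Aa aj] Hj]; exists a => //; exists j.
- by exists a => //; exists s.
Qed.

Variable x0 : idx aleph I.
Hypothesis x0A : A `<=` mc_set x0.2.

Lemma block_lower a a' x : A a' -> (a' <= a)%O -> block a x0 x -> block a' x0 x.
Proof. by move=> /x0A x0a' a'a /block_weaken; apply. Qed.

(* Multiplication by [m] from either side maps matrices supported on the block
   of [a] to matrices supported on the block of [a']. *)
Lemma Hsum_high_block m a : Hsum high m -> A a -> exists2 a', A a' &
  forall x y, m x y != 0 -> (block a x0 x -> block a' x0 y) /\
                            (block a x0 y -> block a' x0 x).
Proof.
move=> /Hsum_high_up[b Ab [s hs mE]] Aa.
have [a' [Aa' a'a a'b]] : exists a', [/\ A a', (a' <= a)%O & (a' <= b)%O].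
  by have [ab|ba] := A_chain Aa Ab; [exists a|exists b].
exists a' => // x y; rewrite mE cfm_sumE => nz.
have [h sh nh] : exists2 h, h \in s & h x y != 0.
  apply: contrapT => nh; move/eqP: nz; apply; rewrite big_seq big1 // => h sh.
  by apply/eqP/negPn/negP => nz; apply: nh; exists h.
have [j bj /Hel_block/(_ nh) hxy] := hs h sh.
have a'j : (a' <= j)%O := le_trans a'b bj.
split=> /(block_lower Aa' a'a) bx; apply: (block_trans bx).
  by apply: block_weaken hxy _ => //; exact: block_r bx.
by apply: block_weaken (block_sym hxy) _ => //; exact: block_r bx.
Qed.

Lemma A_common (a b : I) : A a -> A b -> exists c, [/\ A c, (c <= a)%O & (c <= b)%O].
Proof.
by move=> Aa Ab; have [ab|ba] := A_chain Aa Ab; [exists a|exists b].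
Qed.

(** A column vector is kept as a matrix whose only nonzero column is [x0], so that the action is
    matrix multiplication. The blocks of [x0] grow as [a] decreases along [A], which makes their
    union over [A] closed under addition. *)
Definition columns : set Q := [set v | exists2 a, A a &
  forall x y, v x y != 0 -> y = x0 /\ block a x0 x].

Definition rows : set Q := [set v | exists2 a, A a &
  forall x y, v x y != 0 -> x = x0 /\ block a x0 y].

Lemma columns_zmod : zmod_closed (mem columns).
Proof.
split=> [|v w]; rewrite !inE.
  by have [a Aa] := A0; exists a => // x y; rewrite cfm0E eqxx.
move=> [a Aa va] [b Ab wb]; have [c [Ac ca cb]] := A_common Aa Ab.
exists c => // x y; rewrite cfmDE cfmNE.
have [->|nz _] := eqVneq (v x y) 0.
  rewrite add0r oppr_eq0 => /wb[-> bx]; split=> //; exact: block_lower bx.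
by have [-> bx] := va _ _ nz; split=> //; exact: block_lower bx.
Qed.

Lemma rows_zmod : zmod_closed (mem rows).
Proof.
split=> [|v w]; rewrite !inE.
  by have [a Aa] := A0; exists a => // x y; rewrite cfm0E eqxx.
move=> [a Aa va] [b Ab wb]; have [c [Ac ca cb]] := A_common Aa Ab.
exists c => // x y; rewrite cfmDE cfmNE.
have [->|nz _] := eqVneq (v x y) 0.
  rewrite add0r oppr_eq0 => /wb[-> bx]; split=> //; exact: block_lower bx.
by have [-> bx] := va _ _ nz; split=> //; exact: block_lower bx.
Qed.

Lemma columns_stable m v : Hsum high m -> columns v -> columns (m * v).
Proof.
move=> hm [a Aa va]; have [b Ab mb] := Hsum_high_block hm Aa.
exists b => // x y /cfm_mul_neq0[z /mb[_ zx] /va[-> /zx]].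
by [].
Qed.

Lemma rows_stable m v : Hsum high m -> rows v -> rows (v * m).
Proof.
move=> hm [a Aa va]; have [b Ab mb] := Hsum_high_block hm Aa.
exists b => // x y /cfm_mul_neq0[z /va[-> bz] /mb[/(_ bz)]].
by [].
Qed.

Lemma cfm_unit_columns a x : A a -> block a x0 x -> columns (cfm_unit K x x0).
Proof.
move=> Aa bx; exists a => // z y; rewrite cfm_unitE.
by case: (eqVneq z x) (eqVneq y x0) => [->|_] [->|_]; rewrite ?eqxx.
Qed.

Lemma cfm_unit_rows a x : A a -> block a x0 x -> rows (cfm_unit K x0 x).
Proof.
move=> Aa bx; exists a => // z y; rewrite cfm_unitE.
by case: (eqVneq z x0) (eqVneq y x) => [->|_] [->|_]; rewrite ?eqxx.
Qed.

Lemma Hel_upper_part a m : A a -> Hel a m -> exists r, upper_part r = m.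
Proof.
move=> Aa Hm.
exists (MkB hI (mem_set (Hel_Hsum (J := setT) (j := a) Logic.I Hm))).
apply: upper_part_uniq; last by rewrite subrr; exact: Hsum0.
by apply: Hel_Hsum Hm; apply; exists a.
Qed.

(** With [c] in [A] below both supports, the rank one matrix [t] maps [v] to a nonzero multiple of
    [w]. [Hel_block_lift] replaces [t] by an element of H(I, c) with the same effect on [v]. *)
Lemma columns_trans v w : columns v -> columns w -> v != 0 ->
  exists r, upper_part r * v = w.
Proof.
move=> [a Aa va] [b Ab wb] /cfm_neq0[x [y nz]].
have [c [Ac ca cb]] := A_common Aa Ab.
have vc x' y' : v x' y' != 0 -> y' = x0 /\ block c x0 x'.
  by move=> /va[-> bx']; split=> //; exact: block_lower bx'.
have wc x' y' : w x' y' != 0 -> y' = x0 /\ block c x0 x'.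
  by move=> /wb[-> bx']; split=> //; exact: block_lower bx'.
have [ey bx] := vc _ _ nz; subst y.
pose t : Q := w * cfm_unit K x0 x.
have [|||h Hh ht] := @Hel_block_lift _ _ _ _ _ c x0 t.
- exact: x0A.
- exact/FRMr/FR_cfm_unit.
- move=> x' y'; rewrite cfm_mul_unitE.
  have [->|] := eqVneq y' x; last by rewrite mulr0 eqxx.
  by rewrite mulr1 => /wc[].
have tv : h * v = v x x0 *: w.
  have -> : h * v = t * v.
    apply: cfmP => x' y'; rewrite !cfmME; apply: eq_fsbigr => z _.
    have [->|/vc[_ bz]] := eqVneq (v z y') 0; first by rewrite !mulr0.
    by rewrite ht //; right.
  rewrite -mulrA; have -> : cfm_unit K x0 x * v = v x x0 *: cfm_unit K x0 x0.
    apply: cfmP => x' y'; rewrite cfm_unit_mulE cfmZE cfm_unitE mulrC.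
    have [->|/eqP ny] := eqVneq y' x0; first by rewrite andbT.
    have [->|/vc[]//] := eqVneq (v x y') 0.
    by rewrite andbF mulr0 mul0r.
  apply: cfmP => x' y'; rewrite -cfmZAr !cfmZE cfm_mul_unitE.
  have [->|/eqP ny] := eqVneq y' x0; first by rewrite mulr1.
  by have [->|/wc[]//] := eqVneq (w x' y') 0; rewrite mulr0.
have [r rh] := Hel_upper_part Ac (HelZ (v x x0)^-1 Hh).
exists r; rewrite rh -cfmZAl tv.
by apply: cfmP => x' y'; rewrite !cfmZE mulrA mulVf // mul1r.
Qed.

Lemma rows_trans v w : rows v -> rows w -> v != 0 ->
  exists r, v * upper_part r = w.
Proof.
move=> [a Aa va] [b Ab wb] /cfm_neq0[y [x nz]].
have [c [Ac ca cb]] := A_common Aa Ab.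
have vc x' y' : v x' y' != 0 -> x' = x0 /\ block c x0 y'.
  by move=> /va[-> bx']; split=> //; exact: block_lower bx'.
have wc x' y' : w x' y' != 0 -> x' = x0 /\ block c x0 y'.
  by move=> /wb[-> bx']; split=> //; exact: block_lower bx'.
have [ey bx] := vc _ _ nz; subst y.
pose t : Q := cfm_unit K x x0 * w.
have [|||h Hh ht] := @Hel_block_lift _ _ _ _ _ c x0 t.
- exact: x0A.
- exact/FRM/FR_cfm_unit.
- move=> x' y'; rewrite cfm_unit_mulE.
  have [-> |] := eqVneq x' x; last by rewrite mul0r eqxx.
  by rewrite mul1r => /wc[].
have tv : v * h = v x0 x *: w.
  have -> : v * h = v * t.
    apply: cfmP => x' y'; rewrite !cfmME; apply: eq_fsbigr => z _.
    have [->|/vc[_ bz]] := eqVneq (v x' z) 0; first by rewrite !mul0r.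
    by rewrite ht //; left.
  rewrite mulrA; have -> : v * cfm_unit K x x0 = v x0 x *: cfm_unit K x0 x0.
    apply: cfmP => x' y'; rewrite cfm_mul_unitE cfmZE cfm_unitE.
    have [->|/eqP ny] := eqVneq x' x0; first by [].
    have [->|/vc[]//] := eqVneq (v x' x) 0.
    by rewrite mulr0 mul0r.
  apply: cfmP => x' y'; rewrite -cfmZAl !cfmZE cfm_unit_mulE.
  have [->|/eqP ny] := eqVneq x' x0; first by rewrite mul1r.
  by have [->|/wc[]//] := eqVneq (w x' y') 0; rewrite mul0r.
have [r rh] := Hel_upper_part Ac (HelZ (v x0 x)^-1 Hh).
exists r; rewrite rh -cfmZAr tv.
by apply: cfmP => x' y'; rewrite !cfmZE mulrA mulVf // mul1r.
Qed.

Lemma H_in_B_low r : H_in_B aleph K hI low r <-> upper_part r = 0.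
Proof.
split=> [lr|r0].
  by apply: upper_part_uniq; rewrite ?subr0 //; exact: Hsum0.
by have := upper_part_low r; rewrite r0 subr0.
Qed.

(** Gives faithfulness on both sides: the unit column at [y] and the unit row at [x] each detect
    this entry. *)
Lemma upper_part_support r : upper_part r != 0 -> exists a x y,
  [/\ A a, block a x0 x, block a x0 y & upper_part r x y != 0].
Proof.
move=> nr; have [a Aa ra] := Hsum_high_up (upper_part_high r).
have [x [y [bx byy nz]]] := Hsum_up_support aleph_infinite ra nr (x0A Aa).
by exists a, x, y.
Qed.

Lemma x0_unit_neq0 : cfm_unit K x0 x0 != 0.
Proof.
apply/eqP => /(congr1 (fun m : Q => m x0 x0)).
by rewrite cfm_unitE !eqxx => /eqP; rewrite oner_eq0.
Qed.

Lemma columns_neq0 : exists2 v, columns v & v != 0.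
Proof.
have [a Aa] := A0; exists (cfm_unit K x0 x0); last exact: x0_unit_neq0.
by apply: (cfm_unit_columns Aa); apply: block_refl; exact: x0A Aa.
Qed.

Lemma rows_neq0 : exists2 v, rows v & v != 0.
Proof.
have [a Aa] := A0; exists (cfm_unit K x0 x0); last exact: x0_unit_neq0.
by apply: (cfm_unit_rows Aa); apply: block_refl; exact: x0A Aa.
Qed.

Definition column_action : transitive_action B.
Proof.
refine (@TransitiveAction B Q columns (fun r v => upper_part r * v)
  columns_zmod _ _ _ _ columns_trans columns_neq0).
- by move=> r v; apply: columns_stable; exact: upper_part_high.
- by move=> r s v; rewrite upper_partD mulrDl.
- by move=> r v w; rewrite mulrDr.
- by move=> r s v _; rewrite upper_partM mulrA.
Defined.

(** Products in [B^c] are reversed, which turns multiplication from the right into a left action. *)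
Definition row_action : transitive_action B^c.
Proof.
refine (@TransitiveAction B^c Q rows (fun r v => v * upper_part r)
  rows_zmod _ _ _ _ rows_trans rows_neq0).
- by move=> r v; apply: rows_stable; exact: upper_part_high.
- by move=> r s v; rewrite upper_partD mulrDr.
- by move=> r v w; rewrite mulrDl.
- by move=> r s v _; rewrite -mulrA -upper_partM.
Defined.

Lemma H_in_B_left_primitive : left_primitive (H_in_B aleph K hI low).
Proof.
apply: (left_primitive_action (D := column_action)) => r.
rewrite H_in_B_low /=; split=> [-> v _|rv]; first by rewrite mul0r.
apply/eqP/negPn/negP => /upper_part_support[a [x [y [Aa _ bay nz]]]].
have := congr1 (fun m : Q => m x x0) (rv _ (cfm_unit_columns Aa bay)).
by rewrite cfm_mul_unitE eqxx mulr1; apply/eqP.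
Qed.

Lemma H_in_B_right_primitive : right_primitive (H_in_B aleph K hI low).
Proof.
apply: (left_primitive_action (D := row_action)) => r.
rewrite H_in_B_low /=; split=> [-> v _|rv]; first by rewrite mulr0.
apply/eqP/negPn/negP => /upper_part_support[a [x [y [Aa bax _ nz]]]].
have := congr1 (fun m : Q => m x0 y) (rv _ (cfm_unit_rows Aa bax)).
by rewrite cfm_unit_mulE eqxx mul1r; apply/eqP.
Qed.

End ChainModules.

(** * Every primitive ideal comes from a chain *)

(* Closure under multiplication by [B] from both sides is stated with a single
   product, so that it is the same condition for [B] and [B^c]. *)
Lemma primitive_low (P : set B) :
  P 0 -> (forall r s, P r -> P s -> P (r + s)) ->
  (forall r s b, P b -> P (r * b * s)) ->
  (exists A : set I, [/\ A !=set0, is_chain A,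
     (forall a, A a -> exists2 b, Hel a (B_val b) & ~ P b) &
     forall k, (exists2 b, Hel k (B_val b) & ~ P b) ->
       exists2 a, A a & (a <= k)%O]) ->
  exists A : set I, [/\ A !=set0, is_chain A &
    P = H_in_B aleph K hI (not_above A)].
Proof.
move=> P0 PD PM [A [A0 A_chain AP PA]]; exists A; split=> //.
have lowP b : H_in_B aleph K hI (not_above A) b -> P b.
  move=> /H_in_B_sum[s hs ->]; rewrite big_seq; apply: big_ind => // x.
  move=> /hs[j nj Hx]; apply: contrapT => nP; apply: nj.
  by apply: PA; exists x.
apply/seteqP; split=> [b Pb|//].
apply/H_in_B_low/eqP/negPn/negP => nb.
have [a Aa ba] := Hsum_high_up A_chain A0 (upper_part_high A b).
have [h Hh nPh] := AP _ Aa; apply: nPh.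
pose u : B := MkB hI (mem_set (Hsum_sub (@subsetT _ _) ba)).
have Pu : P u.
  (* [b - u] is the low part of [b], hence in [P]; its negative is written as a two-sided product to
     which [PM] applies. *)
  have -> : u = b + - 1 * (b - u) * 1 by rewrite mulr1 mulN1r opprB addrC subrK.
  by apply: PD => //; apply: PM; apply: lowP; exact: upper_part_low.
suff [h' Ph' /val_inj <- //] : exists2 h', P h' & B_val h' = B_val h.
(* [Hel_sub_ideal] is about sets of matrices, so it is applied to the image of [P] in Q(I). *)
apply: (@Hel_sub_ideal _ _ _ _ _ a (upper_part A b)
  [set m | exists2 h', P h' & B_val h' = m]) => //.
- by exists 0.
- by move=> _ _ [p Pp <-] [q Pq <-]; exists (p + q) => //; exact: PD.
- move=> p q Hp Hq.
  pose p' : B := MkB hI (mem_set (Hel_Hsum (J := setT) (j := a) Logic.I Hp)).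
  pose q' : B := MkB hI (mem_set (Hel_Hsum (J := setT) (j := a) Logic.I Hq)).
  by exists (p' * u * q') => //; exact: PM.
Qed.

Lemma Hel_comparable i j m m' : Hel i m -> Hel j m' -> m * m' != 0 ->
  (i <= j)%O \/ (j <= i)%O.
Proof.
move=> Hm Hm' /cfm_neq0[x [y /cfm_mul_neq0[z]]].
move=> /(Hel_neq0 Hm)/linked_r zi /(Hel_neq0 Hm')/linked_l zj.
exact: mc_chain zi zj.
Qed.

Lemma left_primitive_low (P : set B) : left_primitive P ->
  exists A : set I, [/\ A !=set0, is_chain A &
    P = H_in_B aleph K hI (not_above A)].
Proof.
move=> [V [simV ->]]; apply: primitive_low.
- by move=> v; rewrite scale0r.
- by move=> r s rv sv v; rewrite scalerDl rv sv addr0.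
- by move=> r s b bv v; rewrite -scalerA -scalerA bv scaler0.
apply: (@acting_chain B _ I (fun i b => Hel i (B_val b))) => //.
- by move=> r; apply: H_in_B_sum; exact: B_valP.
- by move=> i j r s ij Hr Hs; exact: (HelM_le ij Hr Hs).
- move=> i j r s Hr Hs nrs; apply: (Hel_comparable Hr Hs).
  by apply: contraNneq nrs => rs0; apply/eqP/val_inj.
Qed.

Lemma right_primitive_low (P : set B) : right_primitive P ->
  exists A : set I, [/\ A !=set0, is_chain A &
    P = H_in_B aleph K hI (not_above A)].
Proof.
move=> [V [simV ->]]; apply: primitive_low.
- by move=> v; rewrite scale0r.
- by move=> r s rv sv v; rewrite scalerDl rv sv addr0.
(* The product [r * b * s] of B(I) is read in the converse ring, where the scalars act. *)
- move=> r s b bv v; rewrite -[LHS]/(((s : B^c) * ((b : B^c) * (r : B^c))) *: v).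
  by rewrite -scalerA -scalerA bv scaler0.
apply: (@acting_chain B^c _ I (fun i b => Hel i (B_val b))) => //.
- by move=> r; apply: H_in_B_sum; exact: B_valP.
- by move=> i j r s ij Hr Hs; have [] := HelM_le ij Hr Hs.
- move=> i j r s Hr Hs nrs; apply/or_comm; apply: (Hel_comparable Hs Hr).
  by apply: contraNneq nrs => rs0; apply/eqP/val_inj.
Qed.

End Primitive.

Theorem proposition6p6
  (d' : Order.disp_t) (aleph : bOrderType d') (aleph_card : infinite_cardinal aleph)
  (K : fieldType)
  (d : Order.disp_t) (I : porderType d)
  (I_aleph : aleph_poset I aleph) (hI : has_finite_cofinal I)
  (P : set (Balg aleph K hI)) :
  (right_primitive P <->
     exists A : set I, [/\ A !=set0, is_chain A &
       P = H_in_B aleph K hI (not_above A)]) /\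
  (left_primitive P <->
     exists A : set I, [/\ A !=set0, is_chain A &
       P = H_in_B aleph K hI (not_above A)]).
Proof.
have [_ _ infA] := aleph_card.
split; split.
- exact: right_primitive_low.
- move=> [A [A0 cA ->]]; have [x0 x0A] := idx_of_chain aleph cA.
  exact: H_in_B_right_primitive x0A.
- exact: left_primitive_low.
- move=> [A [A0 cA ->]]; have [x0 x0A] := idx_of_chain aleph cA.
  exact: H_in_B_left_primitive x0A.
Qed.
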